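(* Let $p$ be a prime, $G$ a cyclic group of order $p$, $\Bbbk$ a field of characteristic $p$, and let $V=V_n$ be the indecomposable representation of $G$ over $\Bbbk$ of dimension $n$, where $2\le n\le p$, with $\Bbbk[V_n]=\Bbbk[x_1,\ldots,x_n]$. Then the $n$ homogeneous invariants $$x_1,\quad N(x_2)=x_1^{p-1}x_2-x_2^p,\quad f_3,\ \ldots,\ f_n$$ are generically separating and generate the invariant field $\Bbbk(V)^G$ as a field extension of $\Bbbk$. Here, for $3\le m\le n$, $f_m$ is the homogeneous invariant of degree $2$ (if $m$ is odd) or $3$ (if $m$ is even) defined in the context.
   Context: Representation. Fix a generator $\sigma$ of $G$. For $1\le n\le p$, $V_n=\Bbbk^n$ is the representation with $\sigma^{-1}(c_1,\ldots,c_n)^t=(c_1,\,c_2+c_1,\,\ldots,\,c_n+c_{n-1})^t$; up to isomorphism $V_1,\ldots,V_p$ are all the indecomposable representations of $G$ over $\Bbbk$. $\Bbbk[V_n]=\Bbbk[x_1,\ldots,x_n]$ is the (formal) polynomial ring in the coordinate functions $x_i$. $G$ acts on it by $\Bbbk$-algebra automorphisms with $(g\cdot f)(v)=f(g^{-1}v)$, so $\sigma(x_1)=x_1$ and $\sigma(x_i)=x_{i-1}+x_i$ for $2\le i\le n$. $\Bbbk[V_n]^G$ is the ring of invariants, $\Bbbk(V_n)=\Bbbk(x_1,\ldots,x_n)$, and $\Bbbk(V_n)^G$ is the field of invariant rational functions. For $m\le n$ we regard $\Bbbk[V_m]=\Bbbk[x_1,\ldots,x_m]\subseteq\Bbbk[V_n]$,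 which is compatible with the action of $G$, so $\Bbbk[V_m]^G\subseteq\Bbbk[V_n]^G$. Generic separation. For a $G$-stable subset $B\subseteq V$, a set $S$ of invariant polynomials is $B$-separating if for any two orbits $Gv\ne Gw$ with $v,w\in B$ there is $f\in S$ with $f(v)\neq f(w)$. A set $S\subseteq \Bbbk[V]^G$ is generically separating if it is $B$-separating for some $G$-stable, nonempty, Zariski open set $B\subseteq V$. Definition of $f_m$. Put $\Delta=\sigma-\mathrm{id}$ on $\Bbbk[V_m]=\Bbbk[x_1,\ldots,x_m]$. (i) $m\ge 3$ odd. Let $W\subseteq\Bbbk[V_m]$ be the span of all monomials of degree 2, and $W_d$ the span of the monomials $x_ix_j$ with $i+j=d$, so $W=\bigoplus_d W_d$. Let $\Delta_d(f)$ denote the $W_d$-component of $\Delta(f)$ for $f\in W$. For $d$ even let $W_d'$ be the span of all monomials in $W_d$ except $x_1x_{d-1}$. Define recursively, for $i=m+1,m,\ldots,3$, $g_i$ as the unique element of $W_i$ (if $i$ is odd), respectively of $W_i'$ (if $i$ is even), with $$\Delta_{i-1}(g_i)=\Delta_{i-1}\Big(x_1x_m-\sum_{j=i+1}^{m+1}g_j\Big).$$ Then $f_m:=x_1x_m-\sum_{j=3}^{m+1}g_j$. (ii) $m\ge 4$ even. Let $S\subseteq\Bbbk[V_m]$ be the span of all monomials of degree 3 divisible by $x_1$ or by $x_2$, and $S_d$ the span of those $x_ix_jx_k\in S$ with $i+j+k=d$, so $S=\bigoplus_d S_d$. Let $\Delta_d(f)$ denote the $S_d$-component of $\Delta(f)\in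 S$ for $f\in S$. For even $d\ge 6$ let $S_d'$ be the span of all monomials in $S_d$ except $x_1^2x_{d-2}$; for odd $d\ge5$ let $\widehat{S_d}$ be the span of all monomials in $S_d$ except $x_1x_{(d-1)/2}^2$. Define recursively, for $i=m+2,m+1,\ldots,4$, $g_i$ as the unique element of $S_i'$ (if $i\ge 6$ is even), of $\widehat{S_i}$ (if $i$ is odd), respectively of $S_4$ (if $i=4$), with $$\Delta_{i-1}(g_i)=\Delta_{i-1}\Big(x_1^2x_m-\sum_{j=i+1}^{m+2}g_j\Big).$$ Then $f_m:=x_1^2x_m-\sum_{j=4}^{m+2}g_j$. The elements $g_i$ exist and are unique because the relevant restrictions of $\Delta_{i-1}$ are isomorphisms onto $W_{i-1}$, respectively $S_{i-1}$; the resulting $f_m$ are $G$-invariant. *)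

(* Defs.v *)
From HB Require Import structures.
From Stdlib Require Import ClassicalEpsilon.
From mathcomp Require Import all_boot all_order all_algebra.
From mathcomp Require Import all_fingroup all_solvable.
From mathcomp Require Import generic_quotient fraction mxrepresentation.
From mathcomp Require Export mpoly.

Set Implicit Arguments.
Unset Strict Implicit.
Unset Printing Implicit Defensive.

Import GRing.Theory.
Local Open Scope ring_scope.

(* Definite description: an element satisfying P, and nothing else does.  The  *)
(* value is meaningful only once [exists! x, P x] has been established.       *)
Definition the (T : Type) (x0 : T) (P : T -> Prop) : T :=
  epsilon (inhabits x0) (unique P).

Section Monomials.
Variables (n : nat) (R : nzRingType).

(* The coordinate function x_i, with the 1-based indexing 1 <= i <= n.  *)
Definition xv (i : nat) : {mpoly R[n]} :=
  if [pick j : 'I_n | j.+1 == i] is Some j then 'X_j else 0.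

(* h lies in the span of the monomials satisfying P.  *)
Definition in_span (P : pred 'X_{1..n}) (h : {mpoly R[n]}) : Prop :=
  {subset msupp h <= P}.

(* The component of h in the span of the monomials satisfying P, with respect *)
(* to the monomial basis.                                                     *)
Definition component (P : pred 'X_{1..n}) (h : {mpoly R[n]}) : {mpoly R[n]} :=
  \sum_(t <- msupp h | P t) h@_t *: 'X_[t].

(* Monomials of the subring R[x_1, ..., x_m].  *)
Definition mon_le (m : nat) : pred 'X_{1..n} :=
  fun t => [forall j : 'I_n, (m <= j)%N ==> (t j == 0%N)].

(* Bases of W_d and, for d even, of W'_d.  The index sum of a monomial, e.g.  *)
(* i + j for x_i x_j, is its weight mnmwgt t = \sum_j t_j * (j + 1), because  *)
(* x_(j+1) is 'X_j.                                                           *)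
Definition Wmon (m d : nat) : pred 'X_{1..n} :=
  fun t => [&& mon_le m t, mdeg t == 2%N & mnmwgt t == d].

Definition Wmon' (m d : nat) : pred 'X_{1..n} :=
  fun t => Wmon m d t
    && (odd d || (('X_[t] : {mpoly R[n]}) != xv 1%N * xv d.-1)).

(* Basis of S_d, and basis of the subspace of S_d in which g_d is sought:     *)
(* S'_d (even d >= 6), \hat S_d (odd d), S_4.  For odd d, d./2 = (d - 1) / 2. *)
Definition Smon (m d : nat) : pred 'X_{1..n} :=
  fun t => [&& mon_le m t, mdeg t == 3%N,
               [exists j : 'I_n, (j < 2)%N && (0 < t j)%N] & mnmwgt t == d].

Definition Smon' (m d : nat) : pred 'X_{1..n} :=
  fun t => Smon m d t
    && (if odd d then ('X_[t] : {mpoly R[n]}) != xv 1%N * xv d./2 ^+ 2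
        else (d == 4%N) || (('X_[t] : {mpoly R[n]}) != xv 1%N ^+ 2 * xv d.-2)).

End Monomials.

Section Action.
Variables (k : fieldType) (n : nat) (gT : finGroupType) (G : {group gT}).
Variable rho : mx_representation k G n.

(* G acts on the left on column vectors, v |-> rho g *m v.                    *)
(* rho is V_n with respect to sigma: sigma^-1 c = (c_1, c_2 + c_1, ...)^t.    *)
Definition is_V (sigma : gT) : Prop :=
  rho (sigma^-1)%g = \matrix_(i, j) ((i == j)%:R + (i == j.+1 :> nat)%:R).

(* (g f)(v) = f (g^-1 v) *)
Definition act (g : gT) (f : {mpoly k[n]}) : {mpoly k[n]} :=
  f \mPo [tuple \sum_(j < n) rho (g^-1)%g i j *: 'X_j | i < n].

Definition invariant (f : {mpoly k[n]}) : Prop :=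
  forall g, g \in G -> act g f = f.

(* The induced action on k(V); since each act g, g \in G, is an automorphism  *)
(* of k[V], the value does not depend on the chosen numerator and             *)
(* denominator.                                                               *)
Definition act_frac (g : gT) (q : {fraction {mpoly k[n]}}) :
    {fraction {mpoly k[n]}} :=
  FracField.tofrac (act g (repr q : {ratio {mpoly k[n]}}).1)
    / FracField.tofrac (act g (repr q : {ratio {mpoly k[n]}}).2).

Definition invariant_frac (q : {fraction {mpoly k[n]}}) : Prop :=
  forall g, g \in G -> act_frac g q = q.

Definition orbitV (v w : 'cV[k]_n) : Prop :=
  exists2 g, g \in G & w = rho g *m v.

Definition evalV (f : {mpoly k[n]}) (v : 'cV[k]_n) : k :=
  f.@[fun i => v i ord0].

Definition zariski_open (B : 'cV[k]_n -> Prop) : Prop :=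
  exists I : {mpoly k[n]} -> Prop,
    forall v, B v <-> exists2 f, I f & evalV f v != 0.

Definition G_stable (B : 'cV[k]_n -> Prop) : Prop :=
  forall g v, g \in G -> B v -> B (rho g *m v).

Definition separating_on (B : 'cV[k]_n -> Prop) (S : {mpoly k[n]} -> Prop) :
    Prop :=
  forall v w, B v -> B w -> ~ (forall u, orbitV v u <-> orbitV w u) ->
    exists2 f, S f & evalV f v <> evalV f w.

Definition generically_separating (S : {mpoly k[n]} -> Prop) : Prop :=
  (forall f, S f -> invariant f) /\
  exists B : 'cV[k]_n -> Prop,
    [/\ G_stable B, exists v, B v, zariski_open B & separating_on B S].

Section Invariants.
Variable sigma : gT.

Definition Delta (f : {mpoly k[n]}) : {mpoly k[n]} := act sigma f - f.

(* r stands for x_1 x_m - \sum_(j > i) g_j, resp.                         *)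
(* x_1^2 x_m - \sum_(j > i) g_j.                                              *)
Definition g_odd (m i : nat) (r : {mpoly k[n]}) : {mpoly k[n]} :=
  the 0 (fun g => in_span (Wmon' k m i) g /\
    component (Wmon m i.-1) (Delta g) = component (Wmon m i.-1) (Delta r)).

Definition g_even (m i : nat) (r : {mpoly k[n]}) : {mpoly k[n]} :=
  the 0 (fun g => in_span (Smon' k m i) g /\
    component (Smon m i.-1) (Delta g) = component (Smon m i.-1) (Delta r)).

(* The folds run over i = m+1, m, ..., 3 and i = m+2, m+1, ..., 4.  *)
Definition f_inv (m : nat) : {mpoly k[n]} :=
  if odd m then
    foldl (fun r i => r - g_odd m i r)
          (xv n k 1%N * xv n k m) (rev (iota 3 m.-1))
  else
    foldl (fun r i => r - g_even m i r)
          (xv n k 1%N ^+ 2 * xv n k m) (rev (iota 4 m.-1)).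

End Invariants.

End Action.

(* The subfield F(S) generated over the image of the scalars.  *)
Definition generated_field (k : fieldType) (n : nat)
    (S : {mpoly k[n]} -> Prop) (q : {fraction {mpoly k[n]}}) : Prop :=
  forall K : {fraction {mpoly k[n]}} -> Prop,
    [/\ K 1, forall x y, K x -> K y -> K (x - y)
      & forall x y, K x -> K y -> K (x / y)] ->
    (forall c : k, K (FracField.tofrac c%:MP)) ->
    (forall f, S f -> K (FracField.tofrac f)) ->
    K q.

(* Main.v *)
Require Import Defs.
From HB Require Import structures.
From Stdlib Require Import Classical ClassicalEpsilon.
From mathcomp Require Import all_boot all_order all_algebra.
From mathcomp Require Import all_fingroup all_solvable.
From mathcomp Require Import generic_quotient fraction mxrepresentation.
From mathcomp Require Import zify ring.
Set Implicit Arguments.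
Unset Strict Implicit.
Unset Printing Implicit Defensive.
Import GRing.Theory.
Local Open Scope ring_scope.
Local Notation act := Defs.act.
Local Notation invariant := Defs.invariant.

(** The generator [sigma] fixes [x_1], sends [x_2] to [x_2 + x_1], and each
    [f_m] has the form [x_1 ^ e x_m + h] with [e] equal to 1 or 2 and [h] a
    polynomial in [x_1, ..., x_(m-1)].  Everything follows from this triangular
    shape.

    Separation holds on the open set [x_1 <> 0].  If [x_1] and [N(x_2)] agree at
    [v] and [w], then the quotient of [x_2(w) - x_2(v)] by [x_1(v)] is fixed by
    the Frobenius map, hence lies in the prime field, and a power of [sigma]
    moves [v] to a point with the same [x_1] and [x_2] as [w].  The [f_m] then
    force the remaining coordinates to agree one after the other
    ([eq_orbit]).

    For the field, let [K] be the field generated by the invariants.  Solving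
    the [f_m] for [x_m] shows that [k[V]] lies in [K[x_2]], and [N(x_2)]
    provides an equation of degree [p] for [x_2]; so every polynomial is the
    value at [x_2] of some [P] over [K] of degree less than [p].  When that
    value is invariant, [P] takes it at the [p] distinct translates
    [x_2 + t x_1], so [P] is constant and the value lies in [K]
    ([invariant_poly_generated]).  Multiplying numerator and denominator by the
    other conjugates of the denominator reduces fractions to polynomials
    ([invariant_generated]).

    The work is in showing that the recursion for the [f_m] is well defined and
    ends in an invariant.  On the component of weight one less, [Delta] acts as
    the derivation [x_j |-> x_(j-1)].  That this map is bijective between the
    spans in question is obtained by proving surjectivity and comparing the
    numbers of monomials ([unique_solution]).  Surjectivity is a computation
    modulo the image: up to sign, consecutive monomials become equal, and going
    once along the whole row of monomials, extended by [x_0 = 0] and folded by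
    the symmetry [x_a x_b = x_b x_a], multiplies a generator of the cokernel by
    a number that is nonzero in characteristic [p] ([quadratic_solvable],
    [cubic_solvable]).  Each step of the recursion kills the top weight
    component of [Delta], and no later step restores it, so that [Delta]
    vanishes at the end ([descent]). *)

(** * Spans of monomials *)

Section Span.
Variables (n : nat) (k : fieldType).
Implicit Types (P Q : pred 'X_{1..n}) (f g h : {mpoly k[n]}) (t : 'X_{1..n}).

Lemma in_spanP P h : in_span P h <-> (forall t, ~~ P t -> h@_t = 0).
Proof.
split=> [Ph t Pt|Ph t]; first by apply/eqP; rewrite mcoeff_eq0; apply: contra Pt => /Ph.
by rewrite mcoeff_msupp; apply: contraR => /Ph ->.
Qed.

Lemma in_span0 P : in_span P (0 : {mpoly k[n]}).
Proof. by apply/in_spanP => t _; rewrite mcoeff0. Qed.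

Lemma in_spanZ P c h : in_span P h -> in_span P (c *: h).
Proof. by move/in_spanP=> Ph; apply/in_spanP => t /Ph; rewrite mcoeffZ => ->;
  rewrite mulr0. Qed.

Lemma in_spanD P g h : in_span P g -> in_span P h -> in_span P (g + h).
Proof.
move=> /in_spanP Pg /in_spanP Ph; apply/in_spanP => t Pt.
by rewrite mcoeffD Pg // Ph // addr0.
Qed.

Lemma in_spanN P h : in_span P h -> in_span P (- h).
Proof. by move/in_spanP=> Ph; apply/in_spanP => t /Ph; rewrite mcoeffN => ->;
  rewrite oppr0. Qed.

Lemma in_spanB P g h : in_span P g -> in_span P h -> in_span P (g - h).
Proof. by move=> Pg Ph; apply: in_spanD => //; apply: in_spanN. Qed.

Lemma in_spanX P t : P t -> in_span P ('X_[t] : {mpoly k[n]}).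
Proof. by move=> Pt u; rewrite msuppX inE => /eqP ->. Qed.

Lemma in_spanS P Q h : (forall t, P t -> Q t) -> in_span P h -> in_span Q h.
Proof. by move=> PQ Ph t /Ph /PQ. Qed.

Lemma mcoeff_component P h t : (component P h)@_t = if P t then h@_t else 0.
Proof.
rewrite /component raddf_sum /=.
under eq_bigr do rewrite mcoeffZ mcoeffX.
case: (boolP (t \in msupp h)) => [th|th]; last first.
  rewrite big_seq_cond big1 ?(memN_msupp_eq0 th) ?if_same // => u /andP[uh _].
  by rewrite (negPf (memPn th u uh)) mulr0.
rewrite big_mkcond (bigD1_seq t) ?msupp_uniq //= eqxx mulr1 big1 ?addr0 //.
by move=> u /negPf ->; rewrite mulr0 if_same.
Qed.

Fact component_is_linear P : linear (component P : {mpoly k[n]} -> _).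
Proof.
move=> c g h; apply/mpolyP => t; rewrite mcoeffD mcoeffZ !mcoeff_component.
by case: ifP; rewrite ?mcoeffD ?mcoeffZ // mulr0 addr0.
Qed.

HB.instance Definition _ P :=
  GRing.isLinear.Build k {mpoly k[n]} {mpoly k[n]} _ (component P)
    (component_is_linear P).

Lemma component_span P h : in_span P (component P h).
Proof. by apply/in_spanP => t Pt; rewrite mcoeff_component (negPf Pt). Qed.

Lemma componentX P t : component P ('X_[t] : {mpoly k[n]}) = if P t then 'X_[t] else 0.
Proof.
apply/mpolyP => u; rewrite mcoeff_component mcoeffX.
case: (eqVneq t u) => [<-|tu]; first by case: ifP; rewrite ?mcoeffX ?eqxx ?mcoeff0.
by rewrite if_same; case: ifP; rewrite ?mcoeffX ?mcoeff0 // (negPf tu).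
Qed.

Lemma span_ind P (K : {mpoly k[n]} -> Prop) :
    K 0 -> (forall g h, K g -> K h -> K (g + h)) ->
    (forall c h, K h -> K (c *: h)) ->
    (forall t, P t -> K 'X_[t]) ->
  forall h, in_span P h -> K h.
Proof.
move=> K0 KD KZ KX h Ph; rewrite (mpolyE h) big_seq.
elim/big_ind: _ => // t /Ph Pt; exact/KZ/KX.
Qed.

Definition span_image P (L : {mpoly k[n]} -> {mpoly k[n]}) h : Prop :=
  exists2 g, in_span P g & L g = h.

Section Image.
Variables (P : pred 'X_{1..n}) (L : {linear {mpoly k[n]} -> {mpoly k[n]}}).

Lemma image0 : span_image P L 0.
Proof. by exists 0; [exact: in_span0 | rewrite linear0]. Qed.

Lemma imageZ c h : span_image P L h -> span_image P L (c *: h).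
Proof. by move=> [g Pg <-]; exists (c *: g); [exact: in_spanZ | rewrite linearZ]. Qed.

Lemma imageD g h : span_image P L g -> span_image P L h -> span_image P L (g + h).
Proof.
by move=> [e Pe <-] [f Pf <-]; exists (e + f); [exact: in_spanD | rewrite linearD].
Qed.

Lemma imageN h : span_image P L h -> span_image P L (- h).
Proof. by rewrite -scaleN1r; exact: imageZ. Qed.

Lemma imageB g h : span_image P L g -> span_image P L h -> span_image P L (g - h).
Proof. by move=> Pg Ph; apply: imageD => //; exact: imageN. Qed.

Lemma imageMn h c : c%:R != 0 :> k -> span_image P L (h *+ c) -> span_image P L h.
Proof.
by move=> c0 /(imageZ c%:R^-1); rewrite -[h *+ c]scaler_nat scalerA mulVf ?scale1r.
Qed.

End Image.

(** Surjectivity and a count of monomials suffice: the matrix of [L] has full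
    row space, and at most as many rows as columns, so its rows are independent.
    The monomials are given by lists because their number is then read off from
    the index ranges. *)
Lemma unique_solution P P' (L : {linear {mpoly k[n]} -> {mpoly k[n]}})
    (M M' : seq 'X_{1..n}) :
    (forall t, P t -> t \in M) -> (forall t, t \in M' -> P' t) ->
    uniq M' -> (size M <= size M')%N ->
    (forall t, P' t -> span_image P L 'X_[t]) ->
  forall r, in_span P' r -> exists! g, in_span P g /\ L g = r.
Proof.
move=> PM M'P' uM' leM surj r Pr.
have [g Pg Lg] : span_image P L r.
  elim/span_ind: r / Pr => //; first exact: image0.
    by move=> ? ?; exact: imageD.
  by move=> ? ?; exact: imageZ.
exists g; split=> [//|h [Ph Lh]].
pose M0 := undup M; pose N := size M0; pose N' := size M'.
pose t0 : 'X_{1..n} := 0%MM.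
pose A : 'M[k]_(N, N') :=
  \matrix_(i, j) (L 'X_[nth t0 M0 i])@_(nth t0 M' j).
have expand f : in_span P f -> f = \sum_(i < N) f@_(nth t0 M0 i) *: 'X_[nth t0 M0 i].
  move=> /in_spanP Pf; rewrite -(big_mkord xpredT (fun i =>
    f@_(nth t0 M0 i) *: 'X_[nth t0 M0 i])).
  rewrite -(big_nth t0 xpredT (fun t => f@_t *: 'X_[t])).
  apply/mpolyP => t; rewrite raddf_sum /=.
  under eq_bigr do rewrite mcoeffZ mcoeffX.
  case: (boolP (t \in M0)) => tM.
    rewrite (bigD1_seq t) ?undup_uniq //= eqxx mulr1 big1 ?addr0 // => u /negPf ->.
    by rewrite mulr0.
  rewrite big_seq big1 ?Pf //; last first.
    by move=> u uM; rewrite (negPf (memPn tM u uM)) mulr0.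
  by apply: contra tM => /PM; rewrite mem_undup.
pose coords f : 'rV[k]_N := \row_i f@_(nth t0 M0 i).
have LA f : in_span P f -> coords f *m A = \row_j (L f)@_(nth t0 M' j).
  move=> Pf; apply/rowP => j; rewrite !mxE [in RHS](expand f Pf) linear_sum raddf_sum /=.
  by apply: eq_bigr => i _; rewrite !mxE linearZ mcoeffZ.
have fullA : row_full A.
  rewrite -sub1mx; apply/row_subP => j; rewrite row1.
  have [e Pe Le] := surj _ (M'P' _ (mem_nth t0 (ltn_ord j))).
  suff -> : delta_mx 0 j = coords e *m A by rewrite submxMl.
  rewrite (LA _ Pe) Le; apply/rowP => l; rewrite !mxE mcoeffX /=.
  by rewrite (nth_uniq t0) ?ltn_ord // eq_sym.
have freeA : row_free A.
  rewrite /row_free eqn_leq rank_leq_row /= (eqP fullA).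
  exact: leq_trans (size_undup M) leM.
have : coords g = coords h by apply: (row_free_inj freeA); rewrite !LA // Lg Lh.
move/rowP => cgh; rewrite (expand g Pg) (expand h Ph).
by apply: eq_bigr => i _; have := cgh i; rewrite !mxE => ->.
Qed.

End Span.

(** * Products of coordinate functions *)

Section Coordinates.
Variable n : nat.
Implicit Types (t : 'X_{1..n}) (a b c m d : nat).

(** The exponent vector of [xv a]; total in [a], so that index arithmetic can
    be done on natural numbers rather than on ordinals. *)
Definition xm a : 'X_{1..n} := [multinom ((j.+1 == a : bool) : nat) | j < n].

Lemma xm_ord (j : 'I_n) : xm j.+1 = U_(j)%MM.
Proof. by apply/mnmP => i; rewrite mnmE mnm1E eqSS eq_sym. Qed.

Lemma xmP a : (0 < a <= n)%N -> exists j : 'I_n, a = j.+1.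
Proof. by case: a => [//|a] /= an; exists (Ordinal an). Qed.

Lemma mdeg_xm a : (0 < a <= n)%N -> mdeg (xm a) = 1%N.
Proof. by case/xmP=> j ->; rewrite xm_ord mdeg1. Qed.

Lemma wgt_xm a : (0 < a <= n)%N -> mnmwgt (xm a) = a.
Proof. by case/xmP=> j ->; rewrite xm_ord mnmwgt1. Qed.

Lemma mon_leD m t u : mon_le m (t + u)%MM = mon_le m t && mon_le m u.
Proof.
apply/forallP/andP => [H|[/forallP Ht /forallP Hu] j].
  by split; apply/forallP => j; apply/implyP => mj; have := H j;
    rewrite mj mnmDE addn_eq0 => /andP[].
by apply/implyP => mj; rewrite mnmDE addn_eq0 (implyP (Ht j)) ?(implyP (Hu j)).
Qed.

Lemma mon_le_xm m a : (0 < a <= n)%N -> mon_le m (xm a) = (a <= m)%N.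
Proof.
move=> an; apply/forallP/idP => [H|am j]; last first.
  by rewrite mnmE; apply/implyP; case: eqP; lia.
rewrite leqNgt; apply/negP => ma; case/xmP: an ma H => j -> ma /(_ j).
by rewrite mnmE eqxx; case: (leqP m j) => //; lia.
Qed.

Lemma xm_split t : (0 < mdeg t)%N ->
  exists a u, [/\ (0 < a <= n)%N, t = (xm a + u)%MM & mdeg u = (mdeg t).-1].
Proof.
rewrite lt0n mdeg_eq0 => tn0.
have [j tj] : exists j, t j != 0%N.
  apply/existsP; apply: contraR tn0; rewrite negb_exists => /forallP t0.
  by apply/eqP/mnmP => j; rewrite mnm0E; apply/eqP; rewrite -[_ == _]negbK t0.
exists j.+1, (t - U_(j))%MM.
have Et : t = (xm j.+1 + (t - U_(j)))%MM by rewrite xm_ord addmC submK // lep1mP.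
split=> //; first by rewrite ltn_ord.
by rewrite [in RHS]Et mdegD xm_ord mdeg1.
Qed.

Lemma xm2P t : mdeg t = 2 -> exists a b,
  [/\ (0 < a)%N, (a <= b)%N, (b <= n)%N & t = (xm a + xm b)%MM].
Proof.
move=> t2; have [|a [u [an Et u1]]] := @xm_split t; first by rewrite t2.
have [|b [v [bn Eu v0]]] := @xm_split u; first by rewrite u1 t2.
have Ev : v = 0%MM by apply/eqP; rewrite -mdeg_eq0 v0 u1 t2.
move: Et; rewrite Eu Ev addm0 => Et.
case: (leqP a b) => ab; first by exists a, b; split=> //; lia.
by exists b, a; split; rewrite 1?addmC //; lia.
Qed.

Lemma xm2_inj a b a' b' : (0 < a)%N -> (a <= b)%N -> (b <= n)%N ->
  (0 < a')%N -> (a' <= b')%N -> (b' <= n)%N ->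
  (xm a + xm b = xm a' + xm b')%MM -> a = a'.
Proof.
move=> a0 ab bn a'0 ab' bn' /mnmP E.
have [|j Ej] := @xmP a; first by lia.
have [|j' Ej'] := @xmP a'; first by lia.
have := E j; have := E j'; rewrite !mnmDE !mnmE -Ej -Ej' !eqxx.
by lia.
Qed.

Variable k : fieldType.
Local Notation x := (xv n k).

Lemma xvE a : (0 < a <= n)%N -> x a = 'X_[xm a].
Proof.
case/xmP=> j ->; rewrite /xv xm_ord; case: pickP => [i /eqP[/val_inj -> //]|].
by move/(_ j); rewrite eqxx.
Qed.

Lemma xv0 : x 0 = 0.
Proof. by rewrite /xv; case: pickP. Qed.

Lemma span_xx (P : pred 'X_{1..n}) a b : (a <= n)%N -> (b <= n)%N ->
  ((0 < a)%N -> (0 < b)%N -> P (xm a + xm b)%MM) -> in_span P (x a * x b).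
Proof.
case: a => [|a] an; first by rewrite xv0 mul0r => *; exact: in_span0.
case: b => [|b] bn H; first by rewrite xv0 mulr0; exact: in_span0.
by rewrite !xvE -?mpolyXD; first exact/in_spanX/H.
Qed.

Lemma component_xx (P : pred 'X_{1..n}) (c : bool) a b : (a <= n)%N -> (b <= n)%N ->
  ((0 < a)%N -> (0 < b)%N -> P (xm a + xm b)%MM = c) ->
  component P (x a * x b) = if c then x a * x b else 0.
Proof.
case: a => [|a] an; first by rewrite xv0 mul0r raddf0 if_same.
case: b => [|b] bn H; first by rewrite xv0 mulr0 raddf0 if_same.
by rewrite !xvE // -mpolyXD componentX H.
Qed.

Lemma Wmon_xx m d a b : (m <= n)%N -> (0 < a <= m)%N -> (0 < b <= m)%N ->
  Wmon m d (xm a + xm b : 'X_{1..n})%MM = (a + b == d).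
Proof.
move=> mn am bm; have an : (0 < a <= n)%N by lia.
have bn : (0 < b <= n)%N by lia.
rewrite /Wmon mon_leD !mon_le_xm // mdegD mnmwgtD !mdeg_xm // !wgt_xm //.
by case/andP: am => _ ->; case/andP: bm => _ ->.
Qed.

(** The smaller index comes first, so that a monomial has only one such form. *)
Lemma WmonP m d t : (m <= n)%N -> Wmon m d t ->
  exists a, [/\ (0 < a)%N, (a <= d - a)%N, (d - a <= m)%N & t = (xm a + xm (d - a))%MM].
Proof.
move=> mn /and3P[tm /eqP t2 /eqP td]; have [a [b [a0 ab bn Et]]] := xm2P t2.
have an : (0 < a <= n)%N by lia.
have bn' : (0 < b <= n)%N by lia.
move: td tm; rewrite Et mnmwgtD mon_leD !wgt_xm // !mon_le_xm // => td /andP[_ bm].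
by exists a; rewrite -td addKn.
Qed.

Lemma Wmon'E m d t : (1 < d <= n.+1)%N ->
  Wmon' k m d t = Wmon m d t && (odd d || (t != (xm 1 + xm d.-1)%MM)).
Proof.
move=> dn; rewrite /Wmon' !xvE; try lia.
rewrite -mpolyXD; congr (_ && (_ || ~~ _)); apply/eqP/eqP => [/mpolyP E|-> //].
by have := E t; rewrite !mcoeffX eqxx; case: eqP => // _ /eqP; rewrite oner_eq0.
Qed.

End Coordinates.

(** * Solving for the quadratic corrections *)

Section Delta.
Variables (k : fieldType) (n : nat) (gT : finGroupType) (G : {group gT}).
Variables (rho : mx_representation k G n) (sigma : gT).
Hypothesis rhoV : is_V rho sigma.
Local Notation x := (xv n k).
Local Notation D := (Delta rho sigma).

HB.instance Definition _ g := GRing.LRMorphism.copy (act rho g)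
  (comp_mpoly [tuple \sum_(j < n) rho (g^-1)%g i j *: 'X_j | i < n]).

Fact Delta_is_linear : linear D.
Proof. by move=> c f h; rewrite /Delta linearP scalerBr addrACA opprD. Qed.

HB.instance Definition _ :=
  GRing.isLinear.Build k {mpoly k[n]} {mpoly k[n]} _ D Delta_is_linear.

(** The case [a = 0] is included: both sides are then zero, and so is the second
    summand when [a = 1]. *)
Lemma act_xv a : (a <= n)%N -> act rho sigma (x a) = x a + x a.-1.
Proof.
case: a => [|a] an; first by rewrite xv0 raddf0 addr0.
pose i := Ordinal an.
have xi : x a.+1 = 'X_i by rewrite -[a.+1]/(i.+1) xvE ?ltn_ord // xm_ord.
rewrite xi /act comp_mpolyXU -tnth_nth tnth_mktuple.
under eq_bigr do rewrite rhoV !mxE scalerDl.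
rewrite big_split /=; congr (_ + _).
  rewrite (bigD1 i) //= eqxx scale1r big1 ?addr0 //.
  by move=> j ji; rewrite eq_sym (negPf ji) scale0r.
clear xi; case: a an @i => [|a] an /=; first by rewrite xv0 big1 // => j _;
  rewrite scale0r.
have an' : (a < n)%N by lia.
pose i' := Ordinal an'; rewrite (bigD1 i') //= eqxx scale1r big1 ?addr0.
  by rewrite -[a.+1]/(i'.+1) xvE ?ltn_ord // xm_ord.
move=> j ji; case: eqP => [E|_]; last by rewrite scale0r.
by case/eqP: ji; apply: val_inj => /=; lia.
Qed.

Lemma Delta_xx a b : (a <= n)%N -> (b <= n)%N ->
  D (x a * x b) = x a * x b.-1 + x a.-1 * x b + x a.-1 * x b.-1.
Proof. by move=> an bn; rewrite /Delta rmorphM /= !act_xv //; ring. Qed.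

Variable m : nat.
Hypothesis mn : (m <= n)%N.

(** Only the terms in which exactly one index drops have weight [d - 1], so on
    this component [Delta] acts as the derivation [x_j |-> x_(j-1)]. *)
Lemma component_Delta_xx d a b : (0 < a <= m)%N -> (0 < b <= m)%N -> a + b = d ->
  component (Wmon m d.-1) (D (x a * x b)) = x a * x b.-1 + x a.-1 * x b.
Proof.
move=> am bm E; rewrite Delta_xx; try lia.
rewrite !raddfD /= (@component_xx _ _ _ true); try (move=> *; rewrite ?Wmon_xx //; lia).
rewrite (@component_xx _ _ _ true); try (move=> *; rewrite ?Wmon_xx //; lia).
by rewrite (@component_xx _ _ _ false) ?addr0; try (move=> *; rewrite ?Wmon_xx //; lia).
Qed.

(** Write [y a = x_a x_(i-1-a)].  Modulo the image, [y a = - y (a - 1)] whenever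
    [x_a x_(i-a)] may be used.  For odd [i] this starts from [y 0 = 0] and kills
    every [y a].  For even [i] it only starts from [y 1], and the symmetric
    element [y (i - 2) = y 1] is reached after an odd number of steps, whence
    [2 y 1 = 0]. *)
Lemma quadratic_solvable i r : 2%:R != 0 :> k -> (3 <= i <= m.+1)%N ->
    in_span (Wmon m i.-1) r ->
  exists! g, in_span (Wmon' k m i) g /\ component (Wmon m i.-1) (D g) = r.
Proof.
move=> char2 im; pose N := i.-1./2; pose e := (~~ odd i : nat).
apply: (unique_solution (L := component (Wmon m i.-1) \o D)
  (M := [seq (xm n a + xm n (i - a))%MM | a <- iota e.+1 N])
  (M' := [seq (xm n a + xm n (i.-1 - a))%MM | a <- iota 1 N])).
- move=> t; rewrite Wmon'E; last lia.
  case/andP=> /(WmonP mn)[a [a0 ab bm ->]] ai.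
  apply/mapP; exists a => //; rewrite mem_iota /e /N; case: (boolP (odd i)) ai => /= oi.
    by lia.
  case: (eqVneq a 1%N) => [->|]; first by rewrite subn1 eqxx.
  by lia.
- move=> t /mapP[a]; rewrite mem_iota => aN ->; rewrite Wmon_xx //; lia.
- rewrite map_inj_in_uniq ?iota_uniq // => a b; rewrite !mem_iota => aN bN.
  by apply: xm2_inj; lia.
- by rewrite !size_map !size_iota.
(* From here on the goal is surjectivity; [I] is the image of the span. *)
pose I := span_image (Wmon' k m i) (component (Wmon m i.-1) \o D).
pose y a := x a * x (i.-1 - a).
have step a : (0 < a < i)%N -> odd i || (1 < a < i.-1)%N -> I (y a + y a.-1).
  move=> ai oi; exists (x a * x (i - a)).
    apply: span_xx => [||a0 b0]; [lia | lia |].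
    rewrite Wmon'E ?Wmon_xx //; try lia.
    case: (odd i) oi => /= oi; first by lia.
    apply/andP; split; first by lia.
    have [ab|ab] := leqP a (i - a); last rewrite addmC.
      by apply/eqP => /xm2_inj; lia.
    by apply/eqP => /xm2_inj; lia.
  rewrite /= component_Delta_xx //; try lia.
  by rewrite /y; congr (x _ * x _ + x _ * x _); lia.
have y0 : y 0 = 0 by rewrite /y xv0 mul0r.
suff Iy a : (a < i)%N -> I (y a).
  move=> t /(WmonP mn)[a [a0 ab bm ->]]; rewrite mpolyXD -!xvE; try lia.
  by apply: Iy; lia.
case: (boolP (odd i)) => oi.
  elim: a => [|a IHa] ai; first by rewrite y0; exact: image0.
  rewrite -(addrK (y a) (y a.+1)); apply: imageB; last by apply: IHa; lia.
  by apply: (step a.+1); rewrite ?oi //; lia.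
have alt b : (b.+1 < i.-1)%N -> I (y b.+1 - (-1) ^+ b *: y 1%N).
  elim: b => [|b IHb] bi; first by rewrite scale1r subrr; exact: image0.
  have -> : y b.+2 - (-1) ^+ b.+1 *: y 1%N =
      (y b.+2 + y b.+1) - (y b.+1 - (-1) ^+ b *: y 1%N).
    by rewrite exprS mulN1r scaleNr; ring.
  by apply: imageB; [apply: (step b.+2); lia | apply: IHb; lia].
have I1 : I (y 1%N).
  apply: (imageMn char2); have := alt i.-1.-2.
  rewrite -signr_odd (_ : odd _ = true); last lia.
  rewrite scaleN1r opprK mulr2n (_ : y _ = y 1%N); first by apply; lia.
  by rewrite /y mulrC; congr (x _ * x _); lia.
case: a => [|a] ai; first by rewrite y0; exact: image0.
have [ai'|ai'] := ltnP a.+1 i.-1; last first.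
  have -> : y a.+1 = 0 by rewrite /y (_ : i.-1 - a.+1 = 0)%N ?xv0 ?mulr0 //; lia.
  exact: image0.
by rewrite -(subrK ((-1) ^+ a *: y 1%N) (y a.+1)); apply: imageD;
  [exact: alt | exact: imageZ].
Qed.

End Delta.

(** * Solving for the cubic corrections *)

Section Cubes.
Variable n : nat.
Implicit Types (t : 'X_{1..n}) (a b c m d : nat).

Lemma xm1_count a (j : 'I_n) : val j = 0%N -> xm n a j = (a == 1)%N.
Proof. by move=> j0; rewrite mnmE -[j.+1]/((val j).+1) j0 eq_sym. Qed.

Lemma Smon_xxx m d c a b : (m <= n)%N ->
  (0 < c <= 2)%N -> (c <= m)%N -> (0 < a <= m)%N -> (0 < b <= m)%N ->
  Smon m d (xm n c + (xm n a + xm n b))%MM = (c + a + b == d).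
Proof.
move=> mn c2 cm am bm.
have an : (0 < a <= n)%N by lia.
have bn : (0 < b <= n)%N by lia.
have cn : (0 < c <= n)%N by lia.
rewrite /Smon !mon_leD !mon_le_xm // !mdegD !mnmwgtD !mdeg_xm // !wgt_xm //.
rewrite (_ : [exists j, _] = true) /=; first by rewrite addnA; lia.
have [j Ej] := xmP cn; apply/existsP; exists j.
by rewrite !mnmDE !mnmE Ej eqxx; lia.
Qed.

(** The first factor is [x_1] whenever [x_1] divides the monomial, so that this
    normal form is unique. *)
Lemma SmonP m d t : (m <= n)%N -> Smon m d t -> exists c a,
  [/\ (0 < c <= 2)%N, (c <= a <= d - c - a)%N, (d - c - a <= m)%N,
      d = (c + a + (d - c - a))%N & t = (xm n c + (xm n a + xm n (d - c - a)))%MM].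
Proof.
move=> mn /and4P[tm /eqP t3 /existsP[j0 /andP[j02 tj0]] /eqP td].
(* Pull out [x_1] if it divides the monomial, and [x_2] otherwise. *)
have [c [u [c2 cn Et c1]]] : exists c u, [/\ (0 < c <= 2)%N, (c <= n)%N,
    t = (xm n c + u)%MM & forall j : 'I_n, val j = 0%N -> (0 < t j)%N -> c = 1%N].
  have pull (j : 'I_n) : (j < 2)%N -> (0 < t j)%N -> exists c u,
      [/\ (0 < c <= 2)%N, (c <= n)%N, t = (xm n c + u)%MM & c = j.+1].
    move=> j2 tj; exists j.+1, (t - U_(j))%MM; split=> //.
    by rewrite xm_ord addmC submK // lep1mP -lt0n.
  case: (pickP [pred j : 'I_n | (val j == 0%N) && (0 < t j)%N]) => [j /andP[/eqP z tj]|no].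
    have [|c [u [c2 cn Et cj]]] := pull j _ tj;
      first by rewrite -[nat_of_ord j]/(val j) z.
    by exists c, u; split=> //; rewrite cj -z.
  have [c [u [c2 cn Et _]]] := pull j0 j02 tj0; exists c, u; split=> // j z tj.
  by have := no j; rewrite /= z eqxx tj.
have c0 : (0 < c <= n)%N by lia.
have /xm2P[a [b [a0 ab bn Eu]]] : mdeg u = 2.
  by move: t3; rewrite Et mdegD mdeg_xm //; lia.
have an : (0 < a <= n)%N by lia.
have b0 : (0 < b <= n)%N by lia.
have ca : (c <= a)%N.
  have [|j Ej] := @xmP n 1; first by lia.
  have z : val j = 0%N by case: Ej.
  have := c1 j z; rewrite Et Eu !mnmDE !xm1_count //.
  by case: (eqVneq a 1%N) => [-> /= H|]; [rewrite H //; lia | lia].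
move: td tm; rewrite Et Eu !mnmwgtD !mon_leD !wgt_xm // !mon_le_xm // =>
  td /and3P[_ _ bm].
exists c, a; have -> : (d - c - a = b)%N by lia.
by split=> //; lia.
Qed.

Variable k : fieldType.
Local Notation x := (xv n k).

Lemma xxxE c a b : (0 < c <= n)%N -> (0 < a <= n)%N -> (0 < b <= n)%N ->
  x c * (x a * x b) = 'X_[xm n c + (xm n a + xm n b)].
Proof. by move=> *; rewrite !xvE // !mpolyXD. Qed.

Lemma span_xxx (P : pred 'X_{1..n}) c a b : (c <= n)%N -> (a <= n)%N -> (b <= n)%N ->
  ((0 < c)%N -> (0 < a)%N -> (0 < b)%N -> P (xm n c + (xm n a + xm n b))%MM) ->
  in_span P (x c * (x a * x b)).
Proof.
case: c => [|c] cn; first by rewrite xv0 mul0r => *; exact: in_span0.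
case: a => [|a] an; first by rewrite xv0 mul0r mulr0 => *; exact: in_span0.
case: b => [|b] bn H; first by rewrite xv0 !mulr0; exact: in_span0.
by rewrite xxxE //; exact/in_spanX/H.
Qed.

Lemma component_xxx (P : pred 'X_{1..n}) (e : bool) c a b :
  (c <= n)%N -> (a <= n)%N -> (b <= n)%N ->
  ((0 < c)%N -> (0 < a)%N -> (0 < b)%N -> P (xm n c + (xm n a + xm n b))%MM = e) ->
  component P (x c * (x a * x b)) = if e then x c * (x a * x b) else 0.
Proof.
case: c => [|c] cn; first by rewrite xv0 mul0r raddf0 if_same.
case: a => [|a] an; first by rewrite xv0 mul0r mulr0 raddf0 if_same.
case: b => [|b] bn H; first by rewrite xv0 !mulr0 raddf0 if_same.
by rewrite xxxE // componentX H.
Qed.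

Lemma Smon'E m d t : (4 <= d <= n.+2)%N -> Smon' k m d t = Smon m d t &&
  (if odd d then t != (xm n 1 + (xm n d./2 + xm n d./2))%MM
   else (d == 4%N) || (t != (xm n 1 + (xm n 1 + xm n d.-2))%MM)).
Proof.
move=> dn; have inj u : ('X_[t] != 'X_[u] :> {mpoly k[n]}) = (t != u).
  congr (~~ _); apply/eqP/eqP => [/mpolyP E|-> //].
  by have := E t; rewrite !mcoeffX eqxx; case: eqP => // _ /eqP; rewrite oner_eq0.
rewrite /Smon' !expr2 -mulrA; congr (_ && _); case: ifP => od.
  by rewrite xxxE ?inj //; lia.
by rewrite xxxE ?inj //; lia.
Qed.

End Cubes.

Section CubicDelta.
Variables (k : fieldType) (n : nat) (gT : finGroupType) (G : {group gT}).
Variables (rho : mx_representation k G n) (sigma : gT).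
Hypothesis rhoV : is_V rho sigma.
Local Notation x := (xv n k).
Local Notation D := (Delta rho sigma).

Lemma Delta_xxx c a b : (c <= n)%N -> (a <= n)%N -> (b <= n)%N ->
  D (x c * (x a * x b)) =
    x c.-1 * (x a * x b) + x c * (x a.-1 * x b) + x c * (x a * x b.-1)
    + (x c * (x a.-1 * x b.-1) + x c.-1 * (x a * x b.-1)
       + x c.-1 * (x a.-1 * x b) + x c.-1 * (x a.-1 * x b.-1)).
Proof. by move=> cn an bn; rewrite /Delta !rmorphM /= !act_xv //; ring. Qed.

Variable m : nat.
Hypothesis mn : (m <= n)%N.

Lemma component_Delta_xxx d c a b :
  (0 < c <= 2)%N -> (c <= m)%N -> (0 < a <= m)%N -> (0 < b <= m)%N -> c + a + b = d ->
  component (Smon m d.-1) (D (x c * (x a * x b))) =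
    x c.-1 * (x a * x b) + x c * (x a.-1 * x b) + x c * (x a * x b.-1).
Proof.
move=> c2 cm am bm E; rewrite Delta_xxx; try lia.
have top c' a' b' : (c' <= c)%N -> (a' <= a)%N -> (b' <= b)%N ->
    component (Smon m d.-1) (x c' * (x a' * x b')) =
    if c' + a' + b' == d.-1 then x c' * (x a' * x b') else 0.
  by move=> *; apply: component_xxx; try lia; move=> *; rewrite Smon_xxx //; lia.
rewrite !raddfD /= !top; try lia.
by do 7![case: eqP => ?; try lia]; rewrite !addr0.
Qed.

(** Write [yA a = x_1 x_a x_(i-2-a)] and [yB a = x_2 x_a x_(i-3-a)], two rows of
    monomials that together span the target.  Modulo the image,
    [yA a = - yA (a - 1)] and [yB a = - yB (a - 1) - yA a].  For odd [i] the
    first relation, starting from [yA 0 = 0], covers the lower half of the row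
    and hence by symmetry all of it, and then the second kills the [yB a].  For
    even [i] one gets [yA a = (-1)^(a-1) s] and [yB a = (-1)^a a s] with
    [s = yA 1]; the end of the second row is [yB (i - 3) = 0], as it contains
    [x_0], so that [(i - 3) s = 0]. *)
Lemma cubic_solvable i r : (i - 3)%:R != 0 :> k -> (4 <= m)%N -> (4 <= i <= m.+2)%N ->
    in_span (Smon m i.-1) r ->
  exists! g, in_span (Smon' k m i) g /\ component (Smon m i.-1) (D g) = r.
Proof.
move=> char_i m4 im; pose h := i./2; pose e := (~~ odd i && (i != 4%N) : nat).
pose A j a := (xm n 1 + (xm n a + xm n (j - 1 - a)))%MM.
pose B j a := (xm n 2 + (xm n a + xm n (j - 2 - a)))%MM.
apply: (unique_solution (L := component (Smon m i.-1) \o D)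
  (M := [seq A i a | a <- iota e.+1 (h.-1 - e)] ++ [seq B i a | a <- iota 2 (h - 2)])
  (M' := [seq A i.-1 a | a <- iota 1 h.-1]
         ++ [seq B i.-1 a | a <- iota 2 (h - 2 - ~~ odd i)])).
- move=> t; rewrite Smon'E; last lia.
  case/andP=> /(SmonP mn)[c [a [c2 cab bm Ei ->]]] ai.
  rewrite mem_cat; have [c1|c1] := eqVneq c 1%N.
    rewrite {}c1 in cab bm Ei ai *; apply/orP; left; apply/mapP; exists a => //.
    rewrite mem_iota /e /h; move: ai; case: (boolP (odd i)) => /= oi.
      case: (eqVneq a i./2) => [E|]; last by lia.
      by rewrite {1 2}E (_ : i - 1 - i./2 = i./2)%N ?eqxx //; lia.
    case: (eqVneq i 4%N) => /= [|i4]; first by lia.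
    case: (eqVneq a 1%N) => [->|]; last by lia.
    by rewrite (_ : i - 1 - 1 = i.-2)%N ?eqxx //; lia.
  have {c1} c1 : c = 2%N by lia.
  rewrite {}c1 in c2 cab bm Ei ai *.
  by apply/orP; right; apply/mapP; exists a => //; rewrite mem_iota /h; lia.
- move=> t; rewrite mem_cat => /orP[] /mapP[a]; rewrite mem_iota /h => aN ->;
    rewrite Smon_xxx //; lia.
- rewrite cat_uniq !map_inj_in_uniq ?iota_uniq //=.
  + rewrite andbT; apply/hasPn => _ /mapP[b bN ->]; apply/negP => /mapP[a aN] /mnmP E.
    have [|j [j0]] := @xmP n 1; first by lia.
    have := E j; rewrite !mnmDE !xm1_count //; move: bN; rewrite mem_iota /h; lia.
  + move=> a b; rewrite !mem_iota /h => aN bN /addmI; apply: xm2_inj; lia.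
  + move=> a b; rewrite !mem_iota /h => aN bN /addmI; apply: xm2_inj; lia.
- by rewrite !size_cat !size_map !size_iota /e /h; lia.
(* From here on the goal is surjectivity; [I] is the image of the span. *)
pose I := span_image (Smon' k m i) (component (Smon m i.-1) \o D).
pose yA a := x 1%N * (x a * x (i - 2 - a)).
pose yB a := x 2%N * (x a * x (i - 3 - a)).
have stepA a : (0 < a < i.-1)%N ->
    (if odd i then a != i./2 else (i == 4%N) || (1 < a < i - 2)%N) ->
    I (yA a + yA a.-1).
  move=> ai oi; exists (x 1%N * (x a * x (i - 1 - a))).
    apply: span_xxx => [|||_ a0 b0]; [lia | lia | lia |].
    rewrite Smon'E ?Smon_xxx; try lia; apply/andP; split; first by lia.
    case: (odd i) oi => /= [oi|/orP[-> //|oi]].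
      apply: contra oi; rewrite eqm_add2l => /eqP.
      have [ab|ab] := leqP a (i - 1 - a); last rewrite [(xm n a + _)%MM]addmC;
        move=> /xm2_inj; lia.
    apply/orP; right; rewrite eqm_add2l; apply/eqP.
    have [ab|ab] := leqP a (i - 1 - a); last rewrite [(xm n a + _)%MM]addmC;
      move=> /xm2_inj; lia.
  rewrite /= component_Delta_xxx //; try lia.
  rewrite xv0 mul0r add0r addrC /yA.
  by congr (x _ * (x _ * x _) + x _ * (x _ * x _)); lia.
have stepB a : (0 < a < i - 2)%N -> (if odd i then (1 < a < i - 3)%N else true) ->
    I (yA a + (yB a + yB a.-1)).
  move=> ai oi; exists (x 2%N * (x a * x (i - 2 - a))).
    apply: span_xxx => [|||_ a0 b0]; [lia | lia | lia |].
    rewrite Smon'E ?Smon_xxx; try lia; apply/andP; split; first by lia.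
    have [|j [j0]] := @xmP n 1; first by lia.
    case: (boolP (odd i)) oi => /= od oi.
      by apply/eqP => /mnmP/(_ j); rewrite !mnmDE !xm1_count //; lia.
    case: (eqVneq i 4%N) => //= i4.
    by apply/eqP => /mnmP/(_ j); rewrite !mnmDE !xm1_count //; lia.
  rewrite /= component_Delta_xxx //; try lia.
  rewrite /yA /yB -addrA [x 2%N * (x a.-1 * _) + _]addrC.
  by congr (x _ * (x _ * x _) + (x _ * (x _ * x _) + x _ * (x _ * x _))); lia.
have yA0 : yA 0%N = 0 by rewrite /yA xv0 mul0r mulr0.
have yB0 : yB 0%N = 0 by rewrite /yB xv0 mul0r mulr0.
have yB_last : yB (i - 3)%N = 0 by rewrite /yB subnn xv0 !mulr0.
suff [IA IB] : (forall a, (a < i - 2)%N -> I (yA a)) /\ (forall a, (a < i - 2)%N -> I (yB a)).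
  move=> t /(SmonP mn)[c [a [c2 cab bm Ei ->]]]; rewrite -xxxE; try lia.
  have [c1|c1] := eqVneq c 1%N.
    rewrite {}c1 in c2 cab bm Ei *.
    have -> : x 1%N * (x a * x (i.-1 - 1 - a)) = yA a.
      by congr (x _ * (x _ * x _)); lia.
    by apply: IA; lia.
  have {c1} c1 : c = 2%N by lia.
  rewrite {}c1 in c2 cab bm Ei *.
  have -> : x 2%N * (x a * x (i.-1 - 2 - a)) = yB a.
    by congr (x _ * (x _ * x _)); lia.
  by apply: IB; lia.
case: (boolP (odd i)) => oi.
  have IA_low a : (a < i./2)%N -> I (yA a).
    elim: a => [|a IHa] ai; first by rewrite yA0; exact: image0.
    rewrite -(addrK (yA a) (yA a.+1)); apply: imageB; last by apply: IHa; lia.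
    by apply: (stepA a.+1); rewrite ?oi; lia.
  have IA a : (a < i - 2)%N -> I (yA a).
    move=> ai; have [al|al] := ltnP a i./2; first exact: IA_low.
    have -> : yA a = yA (i - 2 - a)%N.
      by rewrite /yA [x a * _]mulrC; congr (x _ * (x _ * x _)); lia.
    by apply: IA_low; lia.
  split=> //; elim=> [|a IHa] ai; first by rewrite yB0; exact: image0.
  (* [x_1 x_2 x_(i-3)] may be excluded, but [yB 1] also lies in the first row. *)
  case: (posnP a) => [->|a0].
    have -> : yB 1%N = yA 2%N by rewrite /yB mulrCA; congr (x _ * (x _ * x _)); lia.
    by apply: IA; lia.
  have [al|al] := ltnP a.+1 (i - 3); last first.
    by rewrite (_ : a.+1 = (i - 3)%N) ?yB_last; [exact: image0 | lia].
  have -> : yB a.+1 = (yA a.+1 + (yB a.+1 + yB a)) - yA a.+1 - yB a by ring.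
  apply: imageB; last by apply: IHa; lia.
  by apply: imageB; [apply: (stepB a.+1); rewrite ?oi; lia | apply: IA; lia].
have altA a : (a.+1 < i - 2)%N -> I (yA a.+1 - (-1) ^+ a *: yA 1%N).
  elim: a => [|a IHa] ai; first by rewrite scale1r subrr; exact: image0.
  have -> : yA a.+2 - (-1) ^+ a.+1 *: yA 1%N =
      (yA a.+2 + yA a.+1) - (yA a.+1 - (-1) ^+ a *: yA 1%N).
    by rewrite exprS mulN1r scaleNr; ring.
  apply: imageB; last by apply: IHa; lia.
  by apply: (stepA a.+2); rewrite ?(negPf oi); lia.
have altB a : (a < i - 2)%N -> I (yB a - (-1) ^+ a *: (yA 1%N *+ a)).
  elim: a => [|a IHa] ai; first by rewrite yB0 mulr0n scaler0 subrr; exact: image0.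
  have -> : yB a.+1 - (-1) ^+ a.+1 *: (yA 1%N *+ a.+1) =
      (yA a.+1 + (yB a.+1 + yB a)) - (yA a.+1 - (-1) ^+ a *: yA 1%N)
      - (yB a - (-1) ^+ a *: (yA 1%N *+ a)).
    by rewrite exprS mulN1r scaleNr mulrS scalerDr; ring.
  apply: imageB; last by apply: IHa; lia.
  apply: imageB; last by apply: altA; lia.
  by apply: (stepB a.+1); rewrite ?(negPf oi); lia.
have IA1 : I (yA 1%N).
  apply: (imageMn char_i); have := altB (i - 3)%N.
  rewrite yB_last sub0r -signr_odd (_ : odd _ = true); last lia.
  by rewrite scaleN1r opprK; apply; lia.
split=> [[|a] ai|a ai].
- by rewrite yA0; exact: image0.
- rewrite -(subrK ((-1) ^+ a *: yA 1%N) (yA a.+1)).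
  by apply: imageD; [exact: altA | exact: imageZ].
rewrite -(subrK ((-1) ^+ a *: (yA 1%N *+ a)) (yB a)).
apply: imageD; first exact: altB.
by rewrite -scaler_nat; apply/imageZ/imageZ.
Qed.

End CubicDelta.

(** * The recursion defining the invariants *)

Section Descent.
Variables (n : nat) (k : fieldType) (T : {linear {mpoly k[n]} -> {mpoly k[n]}}).
Variables (P P' : nat -> pred 'X_{1..n}).

Definition weight_lt (Q : nat -> pred 'X_{1..n}) e : pred 'X_{1..n} :=
  fun t => Q (mnmwgt t) t && (mnmwgt t < e)%N.

Variables lo hi : nat.
Hypotheses (P'_wgt : forall d t, P' d t -> mnmwgt t = d)
  (P'P : forall d t, P' d t -> P d t)
  (P_lo : forall d t, P d t -> (lo <= d.+1)%N)
  (T_P : forall d t, P d t -> in_span (weight_lt P d) (T 'X_[t])).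
Hypothesis solvable : forall i r, (lo <= i <= hi)%N -> in_span (P i.-1) r ->
  exists! g, in_span (P' i) g /\ component (P i.-1) (T g) = r.

(** One step of the recursion clears the top weight component of [T r]; since [T]
    lowers weights, the later corrections have lower weight and leave that
    component alone.  At the end [T r] has no weight left to live in. *)
Lemma descent N r : (0 < lo)%N -> (lo + N <= hi.+1)%N ->
    in_span (weight_lt P (lo + N).-1) (T r) ->
  let f := foldl (fun r i => r - the 0 (fun g => in_span (P' i) g /\
      component (P i.-1) (T g) = component (P i.-1) (T r))) r (rev (iota lo N)) in
  T f = 0 /\ in_span (weight_lt P' (lo + N)) (f - r).
Proof.
move=> lo0; elim: N r => [|N IHN] r hiN Tr.
  split; last by rewrite /= subrr; exact: in_span0.
  apply/mpolyP => t; rewrite mcoeff0; apply: (proj1 (in_spanP _ _) Tr).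
  by apply/negP => /andP[/P_lo]; lia.
rewrite -addn1 iotaD cats1 rev_rcons /=.
set i := (lo + N)%N; set Q := fun g => _ /\ _.
have : Q (the 0 Q).
  have ex : exists g0, unique Q g0.
    by apply: solvable; [rewrite /i; lia | exact: component_span].
  by case: (epsilon_spec (inhabits 0) _ ex).
case; move: (the 0 Q) => g Pg Tg.
have [| |Tf fr] := IHN (r - g); first by rewrite /i in hiN *; lia.
  rewrite linearB /=; apply/in_spanP => t Pt; rewrite mcoeffB.
  have Tg0 u : ~~ weight_lt P i u -> (T g)@_u = 0.
    move: u; apply/in_spanP; elim/span_ind: g / Pg {Tg} =>
      [|? ? ? ?|? ? ?|u /P'P/T_P //].
    - by rewrite linear0; exact: in_span0.
    - by rewrite linearD; exact: in_spanD.
    - by rewrite linearZ; exact: in_spanZ.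
  case: (boolP (P i.-1 t)) => [Pit|Pit].
    have /mpolyP/(_ t) := Tg; rewrite !mcoeff_component Pit => ->.
    by rewrite subrr.
  have Pt' : ~~ weight_lt P i t.
    apply: contra Pt => /andP[Pt ti]; rewrite /weight_lt Pt /=.
    suff : mnmwgt t != i.-1 by lia.
    by apply: contra Pit => /eqP <-.
  rewrite Tg0 // subr0; move/in_spanP: Tr; apply.
  by rewrite addnS.
split=> //; move: fr; set F := foldl _ _ _ => fr.
rewrite (_ : F - r = F - (r - g) - g); last by ring.
apply: in_spanB.
  by apply: in_spanS fr => t /andP[Pt ti]; rewrite /weight_lt Pt /=; lia.
apply: in_spanS Pg => t Pt.
by rewrite /weight_lt (P'_wgt Pt) Pt /i /=; lia.
Qed.

End Descent.

Section Invariants.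
Variables (k : fieldType) (n : nat) (gT : finGroupType) (G : {group gT}).
Variables (rho : mx_representation k G n) (sigma : gT).
Hypothesis rhoV : is_V rho sigma.
Local Notation x := (xv n k).
Local Notation D := (Delta rho sigma).
Local Notation f := (f_inv rho sigma).

Lemma Delta_Wmon m d t : (m <= n)%N -> Wmon m d t ->
  in_span (weight_lt (@Wmon n m) d) (D 'X_[t]).
Proof.
move=> mn /(WmonP mn)[a [a0 ab bm ->]]; rewrite mpolyXD -!xvE; try lia.
have W a' b' : (a' <= a)%N -> (b' <= d - a)%N -> (a' + b' < d)%N ->
    in_span (weight_lt (@Wmon n m) d) (x a' * x b').
  move=> la lb lab; apply: span_xx => [||a'0 b'0]; [lia | lia |].
  rewrite /weight_lt mnmwgtD !wgt_xm; try lia.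
  by rewrite Wmon_xx //; lia.
by rewrite (Delta_xx rhoV); try lia; apply: in_spanD; [apply: in_spanD|]; apply: W; lia.
Qed.

Lemma Delta_Smon m d t : (m <= n)%N -> Smon m d t ->
  in_span (weight_lt (@Smon n m) d) (D 'X_[t]).
Proof.
move=> mn /(SmonP mn)[c [a [c2 cab bm Ed ->]]].
rewrite -xxxE; try lia.
have S c' a' b' : (c' <= c)%N -> (a' <= a)%N -> (b' <= d - c - a)%N ->
    (c' + a' + b' < d)%N -> in_span (weight_lt (@Smon n m) d) (x c' * (x a' * x b')).
  move=> lc la lb lab; apply: span_xxx => [|||c'0 a'0 b'0]; [lia | lia | lia |].
  rewrite /weight_lt !mnmwgtD !wgt_xm; try lia.
  by rewrite Smon_xxx //; lia.
rewrite (Delta_xxx rhoV); try lia; rewrite !addrA.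
by do 6![apply: in_spanD; last by apply: S; lia]; apply: S; lia.
Qed.

(** What the proof uses of the invariant [f_m]: it is linear in [x_m], and its
    coefficient there is a power of [x_1]. *)
Definition linear_invariant m (h : {mpoly k[n]}) :=
  let e := if odd m then 1%N else 2%N in
  [/\ D h = 0, h \is e.+1.-homog & in_span (mon_le m.-1) (h - x 1%N ^+ e * x m)].

(** The corrections have weight at most [m + 1], so among their monomials only
    [x_1 x_m] involves [x_m], and this one is excluded from the space in which the
    correction of weight [m + 1] is sought. *)
Lemma f_inv_odd m : odd m -> (3 <= m <= n)%N -> 2%:R != 0 :> k ->
  linear_invariant m (f m).
Proof.
move=> om mn char2; rewrite /linear_invariant /f_inv om expr1.
have Wlead : Wmon m m.+1 (xm n 1 + xm n m)%MM by rewrite Wmon_xx //; lia.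
have lead : x 1%N * x m = 'X_[xm n 1 + xm n m] by rewrite mpolyXD -!xvE //; lia.
have [] := @descent n k D (@Wmon n m) (@Wmon' n k m) 3 m.+1 _ _ _ _ _ m.-1 (x 1%N * x m).
- by move=> d t /andP[/and3P[_ _ /eqP]].
- by move=> d t /andP[].
- by move=> d t /WmonP[|a []]; lia.
- by move=> d t; apply: Delta_Wmon; lia.
- by move=> i r im; apply: (quadratic_solvable rhoV) => //; lia.
- by [].
- by lia.
- by rewrite lead (_ : (3 + m.-1).-1 = m.+1); [apply: Delta_Wmon => //; lia | lia].
move=> Df fr; split=> //.
  rewrite -[foldl _ _ _](subrK (x 1%N * x m)).
  apply: rpredD; last by rewrite lead dhomogX /= mdegD !mdeg_xm //; lia.
  by apply/dhomogP => t /fr /andP[/andP[/and3P[_ /eqP]]].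
apply: in_spanS fr => t /andP[]; set d := mnmwgt t => Pt dm.
case/andP: (Pt) => /WmonP[|a [a0 ab bm Et _]]; first by lia.
have [bm'|bm'] := leqP (d - a) m.-1; first by rewrite Et mon_leD !mon_le_xm //; lia.
move: Pt; rewrite Wmon'E; last lia.
have [Ea Ed] : a = 1%N /\ d = m.+1 by lia.
by rewrite Et Ea Ed /= om subn1 eqxx andbF.
Qed.

(** As in the odd case, with [x_1^2 x_m] and weight [m + 2].  The integers [i - 3]
    that have to be invertible, for even [i <= m + 2], are less than [m]. *)
Lemma f_inv_even m : ~~ odd m -> (4 <= m <= n)%N ->
  (forall j, (0 < j < m)%N -> j%:R != 0 :> k) -> linear_invariant m (f m).
Proof.
move=> om mn char; rewrite /linear_invariant /f_inv (negPf om).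
have Slead : Smon m m.+2 (xm n 1 + (xm n 1 + xm n m))%MM by rewrite Smon_xxx //; lia.
have lead : x 1%N ^+ 2 * x m = 'X_[xm n 1 + (xm n 1 + xm n m)].
  by rewrite -xxxE ?expr2 ?mulrA //; lia.
have [] := @descent n k D (@Smon n m) (@Smon' n k m) 4 m.+2 _ _ _ _ _ m.-1
  (x 1%N ^+ 2 * x m).
- by move=> d t /andP[/and4P[_ _ _ /eqP]].
- by move=> d t /andP[].
- by move=> d t /SmonP[|c [a []]]; lia.
- by move=> d t; apply: Delta_Smon; lia.
- by move=> i r im; apply: (cubic_solvable rhoV) => //; [lia | apply: char; lia | lia].
- by [].
- by lia.
- by rewrite lead (_ : (4 + m.-1).-1 = m.+2); [apply: Delta_Smon => //; lia | lia].
move=> Df fr; split=> //.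
  rewrite -[foldl _ _ _](subrK (x 1%N ^+ 2 * x m)).
  apply: rpredD; last by rewrite lead dhomogX /= !mdegD !mdeg_xm //; lia.
  by apply/dhomogP => t /fr /andP[/andP[/and4P[_ /eqP]]].
apply: in_spanS fr => t /andP[]; set d := mnmwgt t => Pt dm.
case/andP: (Pt) => /SmonP[|c [a [c2 cab bm Ed Et]] _]; first by lia.
have [bm'|bm'] := leqP (d - c - a) m.-1;
  first by rewrite Et !mon_leD !mon_le_xm //; lia.
move: Pt; rewrite Smon'E; last lia.
have [Ec Ea Edm] : [/\ c = 1, a = 1 & d = m.+2]%N by split; lia.
rewrite Et Ec Ea Edm /= negbK (negPf om) !subn1 eqxx orbF => /andP[_]; lia.
Qed.

End Invariants.

(** * The action on polynomials *)

(** Algebra morphisms out of a polynomial ring are determined on the variables;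
    over a finite field, comparing values at points would not suffice. *)
Lemma lrmorphism_eq (k : fieldType) n (S : lalgType k)
    (F H : {lrmorphism {mpoly k[n]} -> S}) :
  (forall i, F 'X_i = H 'X_i) -> F =1 H.
Proof.
move=> FH f; rewrite (mpolyE f) !raddf_sum; apply: eq_bigr => t _.
rewrite /= !linearZ mpolyXE_id !rmorph_prod; congr (_ *: _).
by apply: eq_bigr => i _; rewrite !rmorphXn /= FH.
Qed.

Section Action.
Variables (k : fieldType) (n : nat) (gT : finGroupType) (G : {group gT}).
Variables (rho : mx_representation k G n).
Local Notation x := (xv n k).
Implicit Types (g h : gT) (f : {mpoly k[n]}) (v w : 'cV[k]_n).

Lemma act_X g i : act rho g 'X_i = \sum_(j < n) rho (g^-1)%g i j *: 'X_j.
Proof. by rewrite /act comp_mpolyXU -tnth_nth tnth_mktuple. Qed.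

Lemma act1 f : act rho 1 f = f.
Proof.
apply: (lrmorphism_eq (F := act rho 1) (H := idfun)) => i /=.
rewrite act_X invg1 repr_mx1 (bigD1 i) //= mxE eqxx scale1r big1 ?addr0 // => j ji.
by rewrite mxE eq_sym (negPf ji) scale0r.
Qed.

Lemma actM g h f : g \in G -> h \in G -> act rho (g * h) f = act rho g (act rho h f).
Proof.
move=> Gg Gh; apply: (lrmorphism_eq (F := act rho (g * h)) (H :=
  act rho g \o act rho h)) => i /=.
rewrite !act_X raddf_sum invMg repr_mxM ?groupV //=.
under [RHS]eq_bigr do rewrite linearZ /= act_X scaler_sumr.
rewrite exchange_big; apply: eq_bigr => j _ /=; rewrite mxE scaler_suml.
by apply: eq_bigr => l _; rewrite scalerA.
Qed.

Lemma act_inj g : g \in G -> injective (act rho g).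
Proof.
move=> Gg f h /(congr1 (act rho g^-1)).
by rewrite -!actM ?groupV // mulVg !act1.
Qed.

Lemma evalV_act g f v : evalV (act rho g f) v = evalV f (rho (g^-1)%g *m v).
Proof.
rewrite /evalV /act comp_mpoly_meval; apply: meval_eq => i.
rewrite tnth_mktuple raddf_sum mxE; apply: eq_bigr => j _ /=.
by rewrite mevalZ mevalXU.
Qed.

Lemma evalVD f1 f2 v : evalV (f1 + f2) v = evalV f1 v + evalV f2 v.
Proof. exact: mevalD. Qed.

Lemma evalVB f1 f2 v : evalV (f1 - f2) v = evalV f1 v - evalV f2 v.
Proof. exact: mevalB. Qed.

Lemma evalVM f1 f2 v : evalV (f1 * f2) v = evalV f1 v * evalV f2 v.
Proof. exact: mevalM. Qed.

Lemma evalVX f e v : evalV (f ^+ e) v = evalV f v ^+ e.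
Proof. exact: rmorphXn. Qed.

Lemma invariant_evalV f g v : invariant rho f -> g \in G ->
  evalV f (rho g *m v) = evalV f v.
Proof.
move=> fi Gg; have := evalV_act g^-1 f v.
by rewrite invgK fi ?groupV.
Qed.

Lemma invariant_gen sigma f : G :=: <[sigma]>%g -> act rho sigma f = f ->
  invariant rho f.
Proof.
move=> Gs fs g; have Gsigma : sigma \in G by rewrite Gs cycle_id.
rewrite {1}Gs => /cycleP[j ->]; elim: j => [|j IHj]; first exact: act1.
by rewrite expgS actM ?groupX // IHj.
Qed.

Lemma evalV_inj v w :
  (forall a, (0 < a <= n)%N -> evalV (x a) v = evalV (x a) w) -> v = w.
Proof.
move=> E; apply/colP => i; have := E i.+1.
by rewrite xvE ?ltn_ord // xm_ord /evalV !mevalXU; apply.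
Qed.

(** The span of the monomials in [x_1, ..., x_m] is the algebra generated by these
    variables. *)
Lemma span_mon_le m (K : {mpoly k[n]} -> Prop) :
    (forall c, K c%:MP) -> (forall f1 f2, K f1 -> K f2 -> K (f1 + f2)) ->
    (forall f1 f2, K f1 -> K f2 -> K (f1 * f2)) ->
    (forall a, (0 < a <= n)%N -> (a <= m)%N -> K (x a)) ->
  forall f, in_span (mon_le m) f -> K f.
Proof.
move=> KC KD KM Kx; apply: span_ind => // [|c f Kf|t tm].
- by rewrite -mpolyC0.
- by rewrite -mul_mpolyC; apply: KM.
rewrite mpolyXE_id; elim/big_ind: _ => // [|i _]; first by rewrite -mpolyC1.
have [im|mi] := ltnP i m; last first.
  by have /forallP/(_ i)/implyP/(_ mi)/eqP -> := tm; rewrite expr0 -mpolyC1.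
elim: (t i) => [|e IHe]; first by rewrite expr0 -mpolyC1.
by rewrite exprS; apply: KM => //; rewrite -xm_ord -xvE ?ltn_ord //; apply: Kx;
  rewrite ?ltn_ord.
Qed.

Lemma evalV_mon_le m f v w : in_span (mon_le m) f ->
  (forall a, (0 < a <= n)%N -> (a <= m)%N -> evalV (x a) v = evalV (x a) w) ->
  evalV f v = evalV f w.
Proof.
move=> fm vw; elim/(@span_mon_le m): f / fm => //.
- by move=> c; rewrite /evalV !mevalC.
- by move=> f1 f2 E1 E2; rewrite !evalVD E1 E2.
- by move=> f1 f2 E1 E2; rewrite !evalVM E1 E2.
Qed.

End Action.

(** * Generic separation *)

Lemma natr_inj_pchar (R : nzRingType) p s t : p \in [pchar R] ->
  (s < p)%N -> (t < p)%N -> s%:R = t%:R :> R -> s = t.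
Proof.
move=> Rp; wlog st : s t / (s <= t)%N.
  by move=> W sp tp E; case: (leqP s t) => [|/ltnW] st; [|symmetry]; apply: W.
move=> sp tp /eqP; rewrite eq_sym -subr_eq0 -natrB // -(dvdn_pcharf Rp) => d.
by case: (posnP (t - s)) d => [|ts /(dvdn_leq ts)]; lia.
Qed.

(** The [p] elements of the prime field already exhaust the roots of [X^p - X]. *)
Lemma fixed_Frobenius (F : fieldType) p (e : F) : p \in [pchar F] -> e ^+ p = e ->
  exists t, e = t%:R.
Proof.
move=> Fp ep; have p1 := prime_gt1 (pcharf_prime Fp).
pose P : {poly F} := 'X^p - 'X; pose rs : seq F := [seq t%:R | t <- iota 0 p].
have sP : size P = p.+1 by rewrite size_polyDl size_polyXn // size_polyN size_polyX.
have P0 : P != 0 by rewrite -size_poly_eq0 sP.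
suff : e \in rs by case/mapP => t _ ->; exists t.
apply: contraT => ers.
have := @max_poly_roots _ P (e :: rs) P0; rewrite sP /= size_map size_iota ltnn.
apply; last first.
  rewrite ers map_inj_in_uniq ?iota_uniq // => s t; rewrite !mem_iota.
  exact: natr_inj_pchar.
apply/andP; split; first by rewrite rootE !hornerE ep subrr.
apply/allP => _ /mapP[t _ ->]; rewrite rootE !hornerE.
by rewrite -(pFrobenius_autE Fp) rmorph_nat subrr.
Qed.

(** Equality of [N(x_2)] at two points with the same [x_1 = c] says exactly that
    the difference of their [x_2], measured in units of [c], lies in the prime
    field. *)
Lemma Frobenius_quotient (F : fieldType) p (a b c : F) : p \in [pchar F] -> c != 0 ->
  c ^+ p.-1 * a - a ^+ p = c ^+ p.-1 * b - b ^+ p -> ((b - a) / c) ^+ p = (b - a) / c.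
Proof.
move=> Fp c0 E; have p0 := prime_gt0 (pcharf_prime Fp).
have Eb : (b - a) ^+ p = c ^+ p.-1 * (b - a).
  rewrite -(pFrobenius_autE Fp) rmorphB /= !pFrobenius_autE.
  apply/eqP; rewrite -subr_eq0; apply/eqP.
  have -> : b ^+ p - a ^+ p - c ^+ p.-1 * (b - a)
    = (c ^+ p.-1 * a - a ^+ p) - (c ^+ p.-1 * b - b ^+ p) by ring.
  by rewrite E subrr.
rewrite expr_div_n Eb -{2}(prednK p0) exprSr -mulf_div divff ?mul1r //.
by rewrite expf_neq0.
Qed.

Section Separation.
Variables (p : nat) (k : fieldType) (n : nat) (gT : finGroupType) (G : {group gT}).
Variables (rho : mx_representation k G n) (sigma : gT) (S : {mpoly k[n]} -> Prop).
Local Notation x := (xv n k).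
Hypotheses (k_char : p \in [pchar k]) (n_ge2 : (2 <= n)%N) (Gsigma : sigma \in G)
  (rhoV : is_V rho sigma) (S_inv : forall f, S f -> invariant rho f)
  (S_x1 : S (x 1%N)) (S_N2 : S (x 1%N ^+ p.-1 * x 2%N - x 2%N ^+ p))
  (S_f : forall m, (3 <= m <= n)%N -> exists2 f, S f & linear_invariant rho sigma m f).

Lemma orbit_translate v t : let u := rho (sigma^-1 ^+ t)%g *m v in
  evalV (x 1%N) u = evalV (x 1%N) v /\
  evalV (x 2%N) u = evalV (x 2%N) v + t%:R * evalV (x 1%N) v.
Proof.
elim: t => [|t [IH1 IH2]] /=; first by rewrite expg0 repr_mx1 mul1mx mul0r addr0.
rewrite expgS repr_mxM ?groupX ?groupV // -mulmxA -!evalV_act !(act_xv rhoV) //;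
  last by lia.
rewrite /= xv0 addr0 IH1 evalVD IH1 IH2; split=> //.
by rewrite -natr1 mulrDl mul1r addrA.
Qed.

(** A power of [sigma^-1] makes the first two coordinates agree; then each [f_m]
    is an equation for the [m]-th coordinate with leading coefficient a power of
    [x_1 <> 0]. *)
Lemma eq_orbit v w : evalV (x 1%N) v != 0 ->
  (forall f, S f -> evalV f v = evalV f w) -> exists2 g, g \in G & w = rho g *m v.
Proof.
move=> v1 vw.
have [t Et] : exists t, (evalV (x 2%N) w - evalV (x 2%N) v) / evalV (x 1%N) v = t%:R.
  apply/(fixed_Frobenius k_char)/(Frobenius_quotient k_char v1).
  by have := vw _ S_N2; rewrite !evalVB !evalVM !evalVX -(vw _ S_x1).
exists (sigma^-1 ^+ t)%g; first by rewrite groupX ?groupV.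
have [u1 u2] := orbit_translate v t; set u := _ *m v in u1 u2 *.
have uw f : S f -> evalV f u = evalV f w.
  by move=> Sf; rewrite invariant_evalV ?groupX ?groupV ?vw //; apply: S_inv.
apply/esym/evalV_inj => a; elim/ltn_ind: a => a IHa an.
have [a1|a1] := eqVneq a 1%N; first by rewrite a1 uw.
have [a2|a2] := eqVneq a 2%N.
  by rewrite a2 u2 -Et mulfVK // addrC subrK.
have [|f Sf [_ _ fa]] := @S_f a; first by lia.
have := uw _ Sf; rewrite -[f](subrK (x 1%N ^+ (if odd a then 1 else 2)%N * x a)).
move: (f - _) fa => h fa.
rewrite !evalVD !evalVM !evalVX (uw _ S_x1).
rewrite (evalV_mon_le (w := w) fa); last by move=> b b0 ba; apply: IHa; lia.
by move/addrI/mulfI; apply; rewrite expf_neq0 // -uw // u1.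
Qed.

(** The open set is [x_1 <> 0], which is stable because [x_1] is invariant. *)
Lemma separates_generically : generically_separating rho S.
Proof.
split=> //; exists (fun v => evalV (x 1%N) v != 0); split.
- by move=> g v Gg; rewrite invariant_evalV //; apply: S_inv.
- have [|j Ej] := @xmP n 1; first by lia.
  have xj : x 1%N = 'X_j by rewrite -xm_ord -Ej xvE //; lia.
  by exists (const_mx 1); rewrite xj /evalV mevalXU mxE oner_neq0.
- exists (fun f => f = x 1%N) => v; split=> [v1|[f ->] //].
  by exists (x 1%N).
move=> v w v1 w1 vw; apply: NNPP => no.
have [g Gg Ew] : exists2 g, g \in G & w = rho g *m v.
  apply: eq_orbit => // f Sf; apply/eqP; apply: contraT => /eqP E.
  by case: no; exists f.
case: vw => u; split=> -[h Gh ->].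
  exists (h * g^-1)%g; first by rewrite groupM ?groupV.
  by rewrite Ew mulmxA -repr_mxM ?groupM ?groupV // mulgKV.
by exists (h * g)%g; [rewrite groupM | rewrite Ew mulmxA -repr_mxM].
Qed.

End Separation.

(** * The field of invariants *)

Section Fractions.
Variables (k : fieldType) (n : nat) (gT : finGroupType) (G : {group gT}).
Variables (rho : mx_representation k G n).
Local Notation tof := (@FracField.tofrac {mpoly k[n]}).
Implicit Types (q : {fraction {mpoly k[n]}}) (a b : {mpoly k[n]}).

Lemma frac_repr q : q = tof \n_(repr q) / tof \d_(repr q).
Proof.
set r := repr q; have d0 := denom_ratioP r.
apply: (canRL (mulfK _)); first by rewrite tofrac_eq0.
have -> : q = (\pi_(FracField.type {mpoly k[n]}) r)%qT by rewrite reprK.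
unlock FracField.tofrac; rewrite -[LHS]FracField.pi_mul.
apply/eqmodP; rewrite /= FracField.equivfE /FracField.mulf.
by rewrite !numden_Ratio ?oner_neq0 ?mulf_neq0 ?oner_neq0 // !mulr1 mulrC.
Qed.

Lemma fracP q : exists a b, b != 0 /\ q = tof a / tof b.
Proof. by exists \n_(repr q), \d_(repr q); rewrite -frac_repr denom_ratioP. Qed.

Variable g : gT.
Hypothesis Gg : g \in G.
Local Notation s := (act_frac rho g).

Lemma act_neq0 b : b != 0 -> act rho g b != 0.
Proof. by apply: contra => /eqP b0; apply/eqP/(act_inj (rho := rho) Gg);
  rewrite b0 raddf0. Qed.

(** The value of [act_frac] does not depend on the representative, because [act g]
    is an injective morphism and so respects cross-multiplication. *)
Lemma act_frac_div a b : b != 0 ->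
  s (tof a / tof b) = tof (act rho g a) / tof (act rho g b).
Proof.
move=> b0; rewrite /act_frac; set q := tof a / tof b.
have d0 := denom_ratioP (repr q).
apply/eqP; rewrite eqr_div ?tofrac_eq0 ?act_neq0 // -!tofracM tofrac_eq -!rmorphM /=.
apply/eqP; congr (act _ _ _); apply/eqP;
  rewrite -tofrac_eq !tofracM -eqr_div ?tofrac_eq0 //.
by rewrite -frac_repr.
Qed.

Lemma act_frac_tof a : s (tof a) = tof (act rho g a).
Proof.
have := @act_frac_div a 1 (oner_neq0 _).
by rewrite !rmorph1 !divr1.
Qed.

Fact act_frac_is_zmod_morphism : zmod_morphism s.
Proof.
move=> q r; have [a [b [b0 ->]]] := fracP q; have [c [d [d0 ->]]] := fracP r.
rewrite -mulNr addf_div ?tofrac_eq0 // -tofracN -!tofracM -tofracD.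
rewrite !act_frac_div ?mulf_neq0 // -mulNr addf_div ?tofrac_eq0 ?act_neq0 //.
by rewrite !rmorphD !rmorphM !rmorphN.
Qed.

Fact act_frac_is_monoid_morphism : monoid_morphism s.
Proof.
split=> [|q r]; first by rewrite -tofrac1 act_frac_tof rmorph1.
have [a [b [b0 ->]]] := fracP q; have [c [d [d0 ->]]] := fracP r.
rewrite mulf_div -!tofracM !act_frac_div ?mulf_neq0 // mulf_div.
by rewrite !rmorphM.
Qed.

Definition act_frac_rmorphism : {rmorphism {fraction {mpoly k[n]}} ->
  {fraction {mpoly k[n]}}} :=
  HB.pack s (GRing.isZmodMorphism.Build _ _ s act_frac_is_zmod_morphism)
    (GRing.isMonoidMorphism.Build _ _ s act_frac_is_monoid_morphism).

End Fractions.

Section GeneratedField.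
Variables (k : fieldType) (n : nat) (S : {mpoly k[n]} -> Prop).
Local Notation K := (generated_field S).
Local Notation tof := (@FracField.tofrac {mpoly k[n]}).

Lemma gen_scalar c : K (tof c%:MP).
Proof. by move=> L _ Lc _. Qed.

Lemma gen_mem f : S f -> K (tof f).
Proof. by move=> Sf L _ _; apply. Qed.

Lemma gen1 : K 1.
Proof. by move=> L []. Qed.

Lemma genB u v : K u -> K v -> K (u - v).
Proof. by move=> Ku Kv L HL Lc LS; case: (HL) => _ LB _; apply: LB;
  [exact: Ku | exact: Kv]. Qed.

Lemma gen_div u v : K u -> K v -> K (u / v).
Proof. by move=> Ku Kv L HL Lc LS; case: (HL) => _ _ LM; apply: LM;
  [exact: Ku | exact: Kv]. Qed.

Lemma gen0 : K 0.
Proof. by rewrite -(subrr 1); apply: genB; exact: gen1. Qed.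

Lemma genN u : K u -> K (- u).
Proof. by rewrite -sub0r; apply: genB; exact: gen0. Qed.

Lemma genD u v : K u -> K v -> K (u + v).
Proof. by move=> Ku Kv; rewrite -(opprK v); apply: genB => //; exact: genN. Qed.

Lemma genV u : K u -> K u^-1.
Proof. by rewrite -div1r; apply: gen_div; exact: gen1. Qed.

Lemma genM u v : K u -> K v -> K (u * v).
Proof. by move=> Ku Kv; rewrite -(invrK v); apply: gen_div => //; exact: genV. Qed.

Lemma genX u e : K u -> K (u ^+ e).
Proof.
move=> Ku; elim: e => [|e IHe]; first exact: gen1.
by rewrite exprS; exact: genM.
Qed.

(** With [d] the degree of an equation for [y], this is the ring [K[y]]; the bound
    on the size is what makes the root count of [invariant_poly_generated]
    work. *)
Definition adjoin (y : {fraction {mpoly k[n]}}) (d : nat) u : Prop :=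
  exists P : {poly {fraction {mpoly k[n]}}},
    [/\ forall i, K P`_i, (size P <= d)%N & u = P.[y]].

Variables (y c0 c1 : {fraction {mpoly k[n]}}) (p : nat).
Hypotheses (p_gt1 : (1 < p)%N) (Kc0 : K c0) (Kc1 : K c1)
  (y_eq : y ^+ p = c1 * y + c0).
Local Notation E := (adjoin y p).

Lemma adjoin_base u : K u -> E u.
Proof.
move=> Ku; exists u%:P; split; last by rewrite hornerC.
  by move=> i; rewrite coefC; case: eqP => _ //; exact: gen0.
by apply: leq_trans (size_polyC_leq1 _) _; exact: ltnW.
Qed.

Lemma adjoinD u v : E u -> E v -> E (u + v).
Proof.
move=> [P [KP sP ->]] [Q [KQ sQ ->]]; exists (P + Q); rewrite hornerD; split=> //.
  by move=> i; rewrite coefD; exact: genD.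
by rewrite (leq_trans (size_polyD _ _)) // geq_max sP.
Qed.

Lemma adjoinZ c u : K c -> E u -> E (c * u).
Proof.
move=> Kc [P [KP sP ->]]; exists (c *: P); rewrite hornerZ; split=> //.
  by move=> i; rewrite coefZ; exact: genM.
exact: leq_trans (size_scale_leq _ _) sP.
Qed.

(** Multiplication by [y] shifts the coefficients, and the term of degree [p] is
    removed with the equation for [y]. *)
Lemma adjoin_mul_gen u : E u -> E (u * y).
Proof.
move=> [P [KP sP ->]].
pose a := P`_p.-1; pose Q := P * 'X - a *: ('X^p - (c1 *: 'X + c0%:P)).
have coefQ i : Q`_i = (if i == 0%N then 0 else P`_i.-1)
    - a * ((i == p)%:R - (c1 * (i == 1)%:R + (if i == 0%N then c0 else 0))).
  by rewrite coefB coefMX coefZ coefB coefXn coefD coefZ coefX coefC.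
exists Q; split.
- have Kb (b : bool) : K b%:R by case: b; [exact: gen1 | exact: gen0].
  move=> i; rewrite coefQ; apply: genB; first by case: ifP => _ //; exact: gen0.
  apply: genM; first exact: KP.
  apply: genB; first exact: Kb.
   apply: genD; first exact: genM.
  by case: ifP => _ //; exact: gen0.
- apply/leq_sizeP => i pi; rewrite coefQ.
  have -> : (i == 0%N) = false by lia.
  have -> : (i == 1%N) = false by lia.
  rewrite mulr0 addr0 subr0; case: eqP => [->|ip]; first by rewrite mulr1 subrr.
  by rewrite mulr0 subr0 nth_default // (leq_trans sP) //; lia.
by rewrite /Q hornerD hornerN !hornerE y_eq; ring.
Qed.

Lemma adjoinM u v : E u -> E v -> E (u * v).
Proof.
move=> Eu [P [KP _ ->]]; rewrite horner_coef mulr_sumr.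
elim/big_ind: _ => [||i _]; [by apply: adjoin_base; exact: gen0 | exact: adjoinD |].
rewrite mulrCA; apply: adjoinZ => //; elim: (i : nat) => [|j IHj];
  first by rewrite mulr1.
by rewrite exprSr mulrA; exact: adjoin_mul_gen.
Qed.

End GeneratedField.

Section FieldOfInvariants.
Variables (p : nat) (k : fieldType) (n : nat) (gT : finGroupType) (G : {group gT}).
Variables (rho : mx_representation k G n) (sigma : gT) (S : {mpoly k[n]} -> Prop).
Local Notation x := (xv n k).
Hypotheses (k_char : p \in [pchar k]) (n_ge2 : (2 <= n)%N)
  (Gs : G :=: <[sigma]>%g)
  (rhoV : is_V rho sigma) (S_inv : forall f, S f -> invariant rho f)
  (S_x1 : S (x 1%N)) (S_N2 : S (x 1%N ^+ p.-1 * x 2%N - x 2%N ^+ p))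
  (S_f : forall m, (3 <= m <= n)%N -> exists2 f, S f & linear_invariant rho sigma m f).
Local Notation K := (generated_field S).
Local Notation tof := (@FracField.tofrac {mpoly k[n]}).
Local Notation x1 := (tof (x 1%N)).
Local Notation y := (tof (x 2%N)).
Local Notation E := (adjoin S y p).

Let Gsigma : sigma \in G. Proof. by rewrite Gs cycle_id. Qed.

Lemma generated_invariant q : K q -> invariant_frac rho q.
Proof.
move=> Kq; apply: Kq => [|c g Gg|f Sf g Gg].
- split=> [g Gg|u v Ku Kv g Gg|u v Ku Kv g Gg].
  + exact: (rmorph1 (act_frac_rmorphism rho Gg)).
  + by rewrite [LHS](rmorphB (act_frac_rmorphism rho Gg)) /= Ku ?Kv.
  + by rewrite [LHS](fmorph_div (act_frac_rmorphism rho Gg)) /= Ku ?Kv.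
- by rewrite act_frac_tof // /act comp_mpolyC.
- by rewrite act_frac_tof // S_inv.
Qed.

Lemma x1_neq0 : x 1%N != 0.
Proof. by rewrite xvE -?msupp_eq0 ?msuppX; last lia. Qed.

Let p_gt1 : (1 < p)%N := prime_gt1 (pcharf_prime k_char).

Lemma y_eq : y ^+ p = x1 ^+ p.-1 * y + (- tof (x 1%N ^+ p.-1 * x 2%N - x 2%N ^+ p)).
Proof. by rewrite rmorphB rmorphM !rmorphXn /=; ring. Qed.

Let K_x1 : K x1 := gen_mem S_x1.
Let E_base := @adjoin_base _ _ S y _ p_gt1.
Let E_M := @adjoinM _ _ S y _ _ _ p_gt1 (genN (gen_mem S_N2)) (genX p.-1 K_x1) y_eq.

(** The invariant [f_a] is [x_1 ^ e x_a + h] with [h] in the preceding variables,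
    and [x_1] is invertible in [K]; so [x_a] is found from the earlier ones. *)
Lemma adjoin_xv a : (0 < a <= n)%N -> E (tof (x a)).
Proof.
elim/ltn_ind: a => a IHa an.
have [->|a1] := eqVneq a 1%N; first exact: E_base.
have [->|a2] := eqVneq a 2%N.
  have := @adjoin_mul_gen _ _ S _ _ _ _ p_gt1 (genN (gen_mem S_N2)) (genX p.-1 K_x1) y_eq 1.
  by rewrite mul1r; apply; apply: E_base; exact: gen1.
have [|f Sf [_ _]] := @S_f a; first by lia.
set e := if odd a then _ else _ => fa.
have Eh : E (tof (f - x 1%N ^+ e * x a)).
  apply: (@span_mon_le _ _ a.-1 (fun h => E (tof h))) fa.
  - by move=> c; apply: E_base; exact: gen_scalar.
  - by move=> f1 f2; rewrite rmorphD; exact: adjoinD.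
  - by move=> f1 f2; rewrite rmorphM; exact: E_M.
  - by move=> b bn ba; apply: IHa; lia.
have -> : tof (x a) = (x1 ^+ e)^-1 * (tof f - tof (f - x 1%N ^+ e * x a)).
  rewrite -rmorphB opprB addrC subrK rmorphM rmorphXn mulKf //.
  by rewrite expf_neq0 // tofrac_eq0 x1_neq0.
apply: adjoinZ; first by apply: genV; apply: genX.
rewrite -mulN1r; apply: adjoinD; first by apply: E_base; exact: gen_mem.
by apply: adjoinZ => //; apply: genN; exact: gen1.
Qed.

Lemma adjoin_tofrac f : E (tof f).
Proof.
apply: (@span_mon_le _ _ n (fun f => E (tof f))).
- by move=> c; apply: E_base; exact: gen_scalar.
- by move=> f1 f2; rewrite rmorphD; exact: adjoinD.
- by move=> f1 f2; rewrite rmorphM; exact: E_M.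
- by move=> b bn _; exact: adjoin_xv.
by move=> t _; apply/forallP => j; rewrite leqNgt ltn_ord.
Qed.

(** The coefficients of [P] lie in [K], hence are fixed by [sigma]; so applying
    [sigma] repeatedly to [P(x_2) = f] gives [P(x_2 + t x_1) = f] for all [t].
    These are [p] points, more than the degree of [P - f], and therefore [P] is
    the constant [f]. *)
Lemma invariant_poly_generated f : act rho sigma f = f -> K (tof f).
Proof.
move=> fs; have [P [KP sP Pf]] := adjoin_tofrac f.
pose s := act_frac_rmorphism rho Gsigma.
have sy : s y = y + x1.
  by rewrite /s /= act_frac_tof // (act_xv rhoV) // rmorphD.
have sx : s x1 = x1.
  by rewrite /s /= act_frac_tof // (act_xv rhoV) ?xv0 ?addr0 //; lia.
have translates t : P.[y + t%:R * x1] = tof f.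
  elim: t => [|t IHt]; first by rewrite mul0r addr0.
  transitivity (s (tof f)); last by rewrite /s /= act_frac_tof // fs.
  have sPP : map_poly s P = P.
    by apply/polyP => i; rewrite coef_map /=; exact: (generated_invariant (KP i)).
  rewrite -IHt -horner_map sPP rmorphD rmorphM rmorph_nat sy sx.
  by rewrite -natr1; congr _.[_]; ring.
have Fp : p \in [pchar {fraction {mpoly k[n]}}].
  by apply: (rmorph_pchar tof); rewrite pchar_lalg.
have P0 : P - (tof f)%:P = 0.
  apply: (@roots_geq_poly_eq0 _ _ [seq y + t%:R * x1 | t <- iota 0 p]).
  - apply/allP => _ /mapP[t _ ->].
    by rewrite rootE hornerD hornerN hornerC translates subrr.
  - rewrite map_inj_in_uniq ?iota_uniq // => a b; rewrite !mem_iota => ap bp.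
    move/addrI/mulIf; rewrite tofrac_eq0 x1_neq0 => /(_ isT).
    exact: natr_inj_pchar Fp _ _.
  - rewrite size_map size_iota (leq_trans (size_polyD _ _)) // geq_max sP size_polyN.
    exact: leq_trans (size_polyC_leq1 _) (ltnW p_gt1).
by move/eqP: P0; rewrite subr_eq0 => /eqP PE; have := KP 0%N; rewrite PE coefC.
Qed.

(** The norm [N] of the denominator is an invariant polynomial, and so is the
    product of [N] with the invariant fraction. *)
Lemma invariant_generated q : invariant_frac rho q -> K q.
Proof.
move=> qi; have [a [b [b0 Eq]]] := fracP q.
pose N := \prod_(g in G) act rho g b.
pose M := \prod_(g in G | g != 1%g) act rho g b.
have EN : N = b * M by rewrite /N (bigD1 1%g) //= act1.
have N0 : N != 0 by apply/prodf_neq0 => g Gg; exact: act_neq0.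
have EqN : tof (a * M) = q * tof N.
  by rewrite EN !rmorphM Eq mulrA mulfVK // tofrac_eq0.
have Ninv : act rho sigma N = N.
  rewrite [RHS](reindex_inj (mulgI sigma)) /N rmorph_prod; apply: eq_big => g.
    by rewrite groupMl.
  by move=> Gg; rewrite /= -actM.
have aMinv : act rho sigma (a * M) = a * M.
  apply/eqP; rewrite -tofrac_eq -act_frac_tof // EqN.
  rewrite [act_frac _ _ _](rmorphM (act_frac_rmorphism rho Gsigma)) /= qi //.
  by rewrite act_frac_tof // Ninv.
have -> : q = tof (a * M) / tof N by rewrite EqN mulfK // tofrac_eq0.
by apply: gen_div; exact: invariant_poly_generated.
Qed.

End FieldOfInvariants.

Theorem theorem3 (p : nat) (p_prime : prime p)
    (k : fieldType) (k_char : p \in [pchar k])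
    (gT : finGroupType) (G : {group gT}) (cyclicG : cyclic G)
    (cardG : #|G| = p) (sigma : gT) (gen_sigma : generator G sigma)
    (n : nat) (n_ge2 : (2 <= n)%N) (n_lep : (n <= p)%N)
    (rho : mx_representation k G n) (rhoV : is_V rho sigma) :
  let x := xv n k in
  let N2 := x 1%N ^+ p.-1 * x 2%N - x 2%N ^+ p in
  let f := f_inv rho sigma in
  let gens := [:: x 1%N, N2 & [seq f m | m <- iota 3 (n - 2)]] in
  [/\ x 1%N \is 1.-homog, N2 \is p.-homog
    & forall m, (3 <= m <= n)%N -> f m \is (if odd m then 2 else 3)%N.-homog] /\
  generically_separating rho (fun h => h \in gens) /\
  (forall q : {fraction {mpoly k[n]}},
     invariant_frac rho q <-> generated_field (fun h => h \in gens) q).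
Proof.
move=> x N2 f gens; have p0 := prime_gt0 p_prime.
have nat_neq0 j : (0 < j < p)%N -> j%:R != 0 :> k.
  by move=> jp; rewrite -(dvdn_pcharf k_char) gtnNdvd; case/andP: jp.
have lin m : (3 <= m <= n)%N -> linear_invariant rho sigma m (f m).
  move=> mn; case: (boolP (odd m)) => om.
    by apply: f_inv_odd => //; apply: nat_neq0; lia.
  by apply: f_inv_even => // [|j jm]; [lia | apply: nat_neq0; lia].
have Gs : G :=: <[sigma]>%g by apply/eqP.
have Gsigma : sigma \in G by rewrite Gs cycle_id.
have x1_homog : x 1%N \is 1.-homog.
  by rewrite /x xvE ?dhomogX /= ?mdeg_xm //; lia.
have x2_homog : x 2%N \is 1.-homog.
  by rewrite /x xvE ?dhomogX /= ?mdeg_xm //; lia.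
have act_x1 : act rho sigma (x 1%N) = x 1%N.
  by rewrite (act_xv rhoV) ?xv0 ?addr0 //; lia.
have act_N2 : act rho sigma N2 = N2.
  have mpoly_char : p \in [pchar {mpoly k[n]}] by rewrite pchar_lalg.
  rewrite rmorphB rmorphM !rmorphXn /= act_x1 (act_xv rhoV) //=.
  rewrite -(pFrobenius_autE mpoly_char) rmorphD /= !pFrobenius_autE /N2.
  have -> : xv n k 1 ^+ p = x 1%N ^+ p.-1 * x 1%N by rewrite -exprSr prednK.
  by rewrite /x; ring.
have gens_inv h : h \in gens -> invariant rho h.
  move=> hg; apply: (invariant_gen Gs); move: hg; rewrite !inE.
  case/or3P => [/eqP->|/eqP->|/mapP[m]] //.
  rewrite mem_iota => mn ->; have [|/eqP] := lin m; first by lia.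
  by rewrite subr_eq0 => /eqP.
have gens_x1 : x 1%N \in gens by rewrite !inE eqxx.
have gens_N2 : N2 \in gens by rewrite !inE eqxx orbT.
have gens_f m : (3 <= m <= n)%N -> exists2 h, h \in gens & linear_invariant rho sigma m h.
  move=> mn; exists (f m); last exact: lin.
  by rewrite !inE; apply/or3P/Or33/map_f; rewrite mem_iota; lia.
split; [split=> // [|m mn] | split].
- apply: rpredB; last by have := dhomogMn p x2_homog; rewrite mul1n.
  have := dhomogM (dhomogMn p.-1 x1_homog) x2_homog.
  by rewrite mul1n addn1 prednK.
- by have [_] := lin m mn; case: (odd m).
- exact: (separates_generically k_char n_ge2 Gsigma rhoV).
move=> q; split; last exact: generated_invariant.
exact: (invariant_generated k_char n_ge2 Gs rhoV).
Qed.
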